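(* Let $D$ be an irreducible (classical) knot diagram with $1\le c(D)\le 9$ such that $|D|$ is not one of the irreducible knot projections $P$ with $c(P)=8$ and $d(P)=2$. Then $u_w(D)\le c(D)-I(D)$.
   Context: Knot diagrams are classical diagrams on $S^2$. $c(D)$ (or $c(P)$) is the number of crossings. $|D|$ denotes the knot projection obtained from $D$ by forgetting the crossing information. Regions of a projection are the connected components of its complement in $S^2$. A crossing is reducible if exactly three regions meet around it; a projection is irreducible if it has no reducible crossing, and a diagram $D$ is irreducible if $|D|$ is. Two distinct regions are disconnected if they share no crossing on their boundaries; a set of regions is isolated if any two distinct regions in it are disconnected; $I(P)$ is the maximum cardinality of an isolated set of regions of the projection $P$, and $I(D):=I(|D|)$. Warping degree: for an oriented knot diagram $D$ with a base point $b$ on an edge, a crossing is a warping crossing point of $D_b$ if, travelling along $D$ from $b$ following the orientation, it is first met as an under-crossing; $d(D_b)$ is the number of warping crossing points of $D_b$, and $d(D)=\min_b d(D_b)$ over all base points $b$. For a knot projection $P$, $d(P)$ is the minimum of $d(D')$ over all oriented alternating diagrams $D'$ with $|D'|=P$. Welded unknotting number: a welded knot diagram is a diagram obtained from a classical knot diagram by replacing some classical crossings with welded crossings (carrying no over/under information). A welded knot is an equivalence class of welded knot diagrams under classical and virtual Reidemeister moves (welded crossings playing the role of virtual crossings) and the over forbidden move (the move passing a strand that crosses over two strands across the welded crossing of those two strands). $u_w(D)$ is the minimum number of classical crossings of $D$ that need to be replaced with welded crossings to obtain a diagram of the trivial knot (as a welded knot). *)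

(* Defs.v *)
From HB Require Import structures.
From mathcomp Require Import all_boot all_order all_algebra.
From Stdlib Require Import Relation_Operators.

Set Implicit Arguments.
Unset Strict Implicit.
Unset Printing Implicit Defensive.

(* Curves and diagrams on the oriented sphere, up to isotopy, are encoded as
   follows.  Choose an orientation and a base point on an edge, travel once
   around the curve, and record every passage through a double point (real or
   welded).  The resulting list of passages is read cyclically.  A passage
   records the name of the crossing and a bit telling whether the other strand
   crosses the traveller from right to left; a passage of a diagram moreover
   records at which level the traveller passes.  Thus every crossing is
   recorded twice, with opposite bits.  Such a list determines a 4-valent
   graph with a cyclic order of the half-edges at each vertex, hence a cellular
   embedding in a closed oriented surface; it comes from a curve on the sphere
   iff this surface has genus 0.  The empty list is the simple closed curve. *)

(* Projections *)

Definition pvisit := (nat * bool)%type.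
Definition pmate (v : pvisit) : pvisit := (v.1, ~~ v.2).

Definition projection_code := seq pvisit.

Definition crossings (P : projection_code) : seq nat := undup (map fst P).
Definition crossing_number (P : projection_code) : nat := size (crossings P).

(* Edge i joins passage i to passage i+1 (cyclically).  The code [::] has one
   edge, the whole circle, since (size [::]).-1.+1 = 1. *)
Definition edge (P : projection_code) := 'I_(size P).-1.+1.

(* An edge with a direction of travel, true being that of the code. *)
Definition dart (P : projection_code) := (edge P * bool)%type.

Definition dart_head (P : projection_code) (e : dart P) : edge P :=
  if e.2 then ordS e.1 else e.1.

(* Follow the boundary of the region lying on the left: turn left at the
   crossing that ends the dart.  Passage k is preceded by edge k-1 and followed
   by edge k. *)
Definition face_step (P : projection_code) (e : dart P) : dart P :=
  if onth P (dart_head e) is Some v then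
    let k : edge P := inord (index (pmate v) P) in
    if v.2 == e.2 then (k, true) else (ord_pred k, false)
  else e.

(* A region is given by the darts that have it on their left. *)
Definition regions (P : projection_code) : {set {set dart P}} :=
  [set [set e' | fconnect (@face_step P) e e'] | e : dart P].

Definition on_boundary (P : projection_code) (x : nat) (R : {set dart P}) :=
  [exists e in R, omap fst (onth P (dart_head e)) == Some x].

(* Euler's formula for a connected 4-valent graph with n vertices and 2n edges;
   it also holds for the circle without vertices. *)
Definition spherical (P : projection_code) : bool :=
  #|regions P| == crossing_number P + 2.

Definition reducible_crossing (P : projection_code) (x : nat) : bool :=
  #|[set R in regions P | on_boundary x R]| == 3.

Definition irreducible (P : projection_code) : bool :=
  all (fun x => ~~ reducible_crossing P x) (crossings P).

Definition disconnected (P : projection_code) (R R' : {set dart P}) : bool :=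
  all (fun x => ~~ (on_boundary x R && on_boundary x R')) (crossings P).

Definition isolated (P : projection_code) (S : {set {set dart P}}) : bool :=
  [forall R in S, forall R' in S, (R != R') ==> disconnected R R'].

Definition isolation_number (P : projection_code) : nat :=
  \max_(S : {set {set dart P}} | (S \subset regions P) && isolated S) #|S|.

(* The same curve, for other choices of base point and orientation.  Reversing
   the orientation of the whole curve does not change the crossing bits. *)
Definition same_projection (P Q : projection_code) : Prop :=
  exists k, P = rot k Q \/ P = rot k (rev Q).

(* Diagrams *)

Inductive level := Over | Under | Weld.

Definition level_code (l : level) : option bool :=
  match l with Over => Some true | Under => Some false | Weld => None end.
Definition level_decode (o : option bool) : level :=
  match o with Some true => Over | Some false => Under | None => Weld end.
Lemma level_codeK : cancel level_code level_decode. Proof. by case. Qed.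
HB.instance Definition _ := Equality.copy level (can_type level_codeK).

Definition opposite (l : level) : level :=
  match l with Over => Under | Under => Over | Weld => Weld end.

Record visit := Visit { label : nat; lev : level; side : bool }.

Definition visit_tuple (v : visit) := (label v, lev v, side v).
Definition tuple_visit (t : nat * level * bool) := Visit t.1.1 t.1.2 t.2.
Lemma visit_tupleK : cancel visit_tuple tuple_visit. Proof. by case. Qed.
HB.instance Definition _ := Equality.copy visit (can_type visit_tupleK).

(* The other passage through the same crossing. *)
Definition mate (v : visit) : visit :=
  Visit (label v) (opposite (lev v)) (~~ side v).

Definition diagram_code := seq visit.

Definition shadow (D : diagram_code) : projection_code :=
  [seq (label v, side v) | v <- D].

Definition well_formed (D : diagram_code) : bool :=
  all (fun v => (mate v \in D) && (count_mem (label v) (map label D) == 2)) D.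

Definition welded_diagram (D : diagram_code) : bool :=
  well_formed D && spherical (shadow D).

Definition knot_diagram (D : diagram_code) : bool :=
  welded_diagram D && all (fun v => lev v != Weld) D.

Definition least (A : nat -> Prop) (n : nat) : Prop :=
  A n /\ forall m, A m -> n <= m.

(* Warping degree *)

(* The base point is the one from which the list starts. *)
Definition based_warping_degree (D : diagram_code) : nat :=
  count (fun v => (lev v == Under) && (index v D < index (mate v) D)) D.

Definition warping_degree (D : diagram_code) : nat :=
  \big[minn/based_warping_degree D]_(k < size D) based_warping_degree (rot k D).

Definition alternating (D : diagram_code) : bool :=
  cycle (fun u v => lev v == opposite (lev u)) D.

Definition projection_warping_degree (P : projection_code) (n : nat) : Prop :=
  least (fun m => exists D, [/\ knot_diagram D, alternating D,
                               same_projection (shadow D) P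
                             & warping_degree D = m]) n.

(* Welded knots *)

Definition relabel (f : nat -> nat) (v : visit) : visit :=
  Visit (f (label v)) (lev v) (side v).

(* A strand passing v then w if o, and w then v otherwise. *)
Definition strand (o : bool) (v w : visit) : seq visit :=
  if o then [:: v; w] else [:: w; v].

(* Moves are written up to base point; those creating or permuting crossings
   are only used between codes of diagrams on the sphere (see move below).

   r1: a kink, real (Reidemeister I) or welded (virtual I).

   r2: two strands crossing twice in a row, always at the same level, and once
   in each direction, so that they bound a bigon.  Real: Reidemeister II;
   welded: virtual II.  The second strand may run in either direction.

   r3: three strands bound a triangle whose corners are the crossings of a, b
   and c.  Walk around it through edges a -> b, mate b -> c, mate c -> mate a,
   with the triangle on the left if h = false and on the right if h = true;
   op, oq, or tell whether these edges are walked along their orientation.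
   The conditions on the sides express that one turns into the triangle at each
   corner.  The move exchanges the two passages on each of the three strands.
   The first strand (any of the three, up to base point) must pass at the same
   level, over or welded, at both of its crossings:
     over,   third crossing real:   Reidemeister III (the top strand is first);
     over,   third crossing welded: the over forbidden move;
     welded, third crossing welded: virtual III;
     welded, third crossing real:   the mixed move. *)
Inductive basic_move : diagram_code -> diagram_code -> Prop :=
| move_base_point k D :
    basic_move D (rot k D)
| move_relabel f D : injective f ->
    basic_move D (map (relabel f) D)
| move_r1 v D :
    basic_move D ([:: v; mate v] ++ D)
| move_r2 u v o A B : lev u = lev v -> side u = ~~ side v ->
    basic_move (A ++ B) ([:: u; v] ++ A ++ strand o (mate u) (mate v) ++ B)
| move_r3 a b c h op oq or A B C :
    lev a = lev b -> lev a != Under ->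
    side b = h (+) (op == oq) ->
    side c = h (+) (oq == or) ->
    side (mate a) = h (+) (or == op) ->
    basic_move
      (strand op a b ++ A ++ strand oq (mate b) c ++ B
                     ++ strand or (mate c) (mate a) ++ C)
      (strand (~~ op) a b ++ A ++ strand (~~ oq) (mate b) c ++ B
                          ++ strand (~~ or) (mate c) (mate a) ++ C).

Definition move (D D' : diagram_code) : Prop :=
  [/\ welded_diagram D, welded_diagram D' & basic_move D D'].

Definition welded_equivalent : diagram_code -> diagram_code -> Prop :=
  clos_refl_sym_trans diagram_code move.

Definition welded_trivial (D : diagram_code) : Prop :=
  welded_equivalent D [::].

(* Replace the crossings in S by welded crossings. *)
Definition weld (S : seq nat) (D : diagram_code) : diagram_code :=
  [seq if label v \in S then Visit (label v) Weld (side v) else v | v <- D].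

Definition classical_crossings (D : diagram_code) : seq nat :=
  undup [seq label v | v <- D & lev v != Weld].

Definition welded_unknotting_number (D : diagram_code) (n : nat) : Prop :=
  least (fun m => exists S : seq nat,
           [/\ uniq S, {subset S <= classical_crossings D}, size S = m
             & welded_trivial (weld S D)]) n.

(* Main.v *)
Require Import Defs.
From mathcomp Require Import all_boot all_order all_algebra.
From mathcomp Require Import zify.
From Stdlib Require Import Relation_Operators Classical_Prop.

(** Both sides are compared with half the number c of crossings.  A region of an
    irreducible projection has at least two crossings on its boundary, and the
    regions of an isolated set share none, so 2 I(D) <= c.  For the other half,
    travel once around D from the base point: the crossings are divided into
    those first met from above and those first met from below.  Welding the
    latter leaves a descending diagram, welding the former leaves one that is
    descending for the opposite direction of travel; both are trivial as welded
    knots, so 2 u_w(D) <= c.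

    Why a descending welded diagram is trivial.  In the word of its real passages,
    two consecutive over passages may be exchanged ([tail_swap]) and a
    crossing whose two passages are consecutive may be deleted
    ([chord_removal]).  A descending word is erased in this way
    ([descending_ind]), and a diagram without real crossings remains, which is
    trivial ([welded_word_trivial]).

    In a diagram on the sphere, consecutive real passages may be separated by
    welded ones, and so two geometric facts are needed.  Two consecutive passages
    can be exchanged, at the price of two new welded crossings, unless both are
    real and one is an under passage ([equiv_swap]); this is where the over
    forbidden move comes in.  A loop of welded passages can be deleted
    ([loop_removal]).  If the loop is simple, exchanges push every crossing out of
    the disc that it bounds ([push_out]); the rest of the curve then meets the
    disc in disjoint arcs, an innermost one cuts off a bigon
    ([adjacent_chord]), which a second Reidemeister move removes, and at the end
    the loop is a kink.

    Sphericity is defined by counting regions.  It is used, and followed through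
    the moves, in an equivalent form ([sphericalP]): every flow modulo 2 on the
    curve is the boundary of a set of regions.  Such a set is recorded by its
    values at the four corners of each crossing, so that a move requires new
    values in a small disc only.  The inside of a loop, and the fact that disjoint
    arcs inside it do not interlace, are obtained from the flows that run around
    the loop ([loop_colouring]) and around the parts of the disc cut off by an arc
    ([chord_colouring]). *)

Set Implicit Arguments.
Unset Strict Implicit.
Unset Printing Implicit Defensive.

(** * Colourings of the regions *)

(** The values of a Z/2-valued function on the regions, read at the four corners
    of a crossing: ((NW, NE), (SW, SE)), where the strand whose recorded bit is
    true runs east and the other one, which crosses it from right to left, runs
    north.  Since a code lists passages, the corners determine the values on
    the two sides of every edge. *)
Definition corners := ((bool * bool) * (bool * bool))%type.
Definition colouring := nat -> corners.

(** The values on the left and on the right of the edge that arrives at the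
    passage [v]; [after] is the same for the edge that leaves it. *)
Definition before (k : colouring) (v : pvisit) : bool * bool :=
  let: ((nw, ne), (sw, se)) := k v.1 in if v.2 then (nw, sw) else (sw, se).
Definition after (k : colouring) (v : pvisit) : bool * bool :=
  let: ((nw, ne), (sw, se)) := k v.1 in if v.2 then (ne, se) else (nw, ne).

(** The corners fit together along the path [s]: it is entered by an edge with
    side values [i] and left by an edge with side values [o]. *)
Fixpoint traverses (k : colouring) (i : bool * bool) (s : projection_code)
    (o : bool * bool) : bool :=
  if s is v :: s' then (before k v == i) && traverses k (after k v) s' o else i == o.

(** A function on the regions changes by its [flow] across an edge; [jump] is
    the amount by which the flow of either strand changes at the crossing. *)
Definition jump (c : corners) : bool :=
  c.1.1 (+) c.1.2 (+) (c.2.1 (+) c.2.2).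

Definition flow (e : bool * bool) : bool := e.1 (+) e.2.

(** A flow modulo 2 on the curve is given by its jumps at the crossings and by
    its value on one edge; the curve is colourable when every flow is the
    boundary of a set of regions, that is, has trivial homology class. *)
Definition colourable (P : projection_code) : Prop :=
  forall (eps : nat -> bool) (z : bool), exists (k : colouring) (i : bool * bool),
    [/\ (forall x, x \in map fst P -> jump (k x) = eps x),
        traverses k i P i & flow i = z].

Lemma flow_after k v : flow (after k v) = flow (before k v) (+) jump (k v.1).
Proof.
rewrite /flow /after /before /jump; case: (k v.1) => [[nw ne] [sw se]] /=.
by case: v.2; case: nw; case: ne; case: sw; case: se.
Qed.

Lemma traverses_cat k i s t o :
  traverses k i (s ++ t) o <-> exists2 m, traverses k i s m & traverses k m t o.
Proof.
elim: s i => [|v s IH] i /=.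
  by split=> [|[m /eqP->]] //; exists i.
split=> [/andP[-> /IH[m h1 h2]]|[m /andP[-> h1 h2]]]; first by exists m.
by apply/IH; exists m.
Qed.

Lemma traverses_flow k i s o :
  traverses k i s o -> flow o = flow i (+) odd (count (fun v => jump (k v.1)) s).
Proof.
elim: s i => [|v s IH] i /=; first by move/eqP->; rewrite addbF.
case/andP=> /eqP<- /IH->; rewrite flow_after oddD.
by case: jump; rewrite ?addbF ?addbT ?addNb ?addbN.
Qed.

(** Moving the base point replaces the prescribed value on the first edge by
    the value that the flow has on the new first edge. *)
Lemma colourable_rot s t : colourable (s ++ t) -> colourable (t ++ s).
Proof.
move=> col eps z.
have [k [i [e /traverses_cat[m h1 h2] fl]]] :=
  col eps (z (+) odd (count (fun v => eps v.1) s)).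
exists k, m; split.
- move=> x xs; apply: e; move: xs; rewrite !map_cat !mem_cat orbC //.
- by apply/traverses_cat; exists i.
rewrite (traverses_flow h1) fl.
rewrite (@eq_in_count _ (fun v => jump (k v.1)) (fun v => eps v.1)).
  by rewrite -addbA addbb addbF.
by move=> v vs; apply: e; rewrite map_cat mem_cat map_f.
Qed.

Lemma traverses_kink k i m x b : traverses k i [:: (x, b); (x, ~~ b)] m -> i = m.
Proof.
rewrite /= /before /after /=; case: (k x) => [[nw ne] [sw se]] /=.
by case: b => /=; case/and3P=> /eqP<- /eqP[->] /eqP<-.
Qed.

Lemma colourable_kink x b P : x \notin map fst P ->
  colourable ([:: (x, b); (x, ~~ b)] ++ P) -> colourable P.
Proof.
move=> xP col eps z.
have [k [i [e /traverses_cat[m /traverses_kink<- h2] fl]]] := col eps z.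
exists k, i; split=> // y yP; apply: e; rewrite map_cat mem_cat yP orbT //.
Qed.

(** With no jump at the two corners of a bigon, the flow is constant along both
    strands, and so are their side values after the bigon has been removed. *)
Lemma traverses_bigon k i m x y b : jump (k x) = false -> jump (k y) = false ->
    traverses k i [:: (x, b); (y, ~~ b)] m ->
  forall o j n, traverses k j (if o then [:: (x, ~~ b); (y, b)] else [:: (y, b); (x, ~~ b)]) n ->
  i = m /\ j = n.
Proof.
move=> hx hy h o j n; move: hx hy h.
case: o; case: b; rewrite /= /before /after /jump /=;
  case: (k x) => [[nw ne] [sw se]] /=; case: (k y) => [[nw' ne'] [sw' se']] /= hx hy;
  case/and3P=> /eqP<- /eqP[? ?] /eqP<-;
  case/and3P=> /eqP<- /eqP[? ?] /eqP<-; subst;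
  move: hx hy; clear;
  repeat match goal with b : bool |- _ => destruct b end; by [].
Qed.

(** * Regions as orbits of darts *)

Definition well_paired (P : projection_code) : bool :=
  all (fun v => (pmate v \in P) && (count_mem v.1 (map fst P) == 2)) P.

Lemma pmateK : involutive pmate.
Proof. by case=> x s; rewrite /pmate negbK. Qed.

Section Faces.
Variable P : projection_code.
Hypothesis wP : well_paired P.

Lemma mem_pmate v : v \in P -> pmate v \in P.
Proof. by move/(allP wP)/andP=> []. Qed.

Lemma well_paired_uniq : uniq P.
Proof.
apply/count_mem_uniq => v; have [vP|] := boolP (v \in P); last first.
  by move/count_memPn.
have /andP[mv /eqP c2] := allP wP v vP.
have : count_mem v P + count_mem (pmate v) P <= count_mem v.1 (map fst P).
  rewrite count_map -count_predUI.
  have -> : count (predI (pred1 v) (pred1 (pmate v))) P = 0.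
    rewrite (eq_count (a2 := pred0)) ?count_pred0 // => u /=.
    by apply/negP=> /andP[/eqP-> /eqP/(congr1 snd)] /=; case: v.2.
  by rewrite addn0; apply: sub_count => u /= /orP[]/eqP->.
rewrite c2; move: vP mv; rewrite -!has_pred1 !has_count; lia.
Qed.

Hypothesis P0 : P != [::].

Let N := (size P).-1.+1.
Let sizeP : size P = N.
Proof. by rewrite /N; case: P P0. Qed.

Let lt_size (j : edge P) : j < size P.
Proof. by apply: leq_trans (ltn_ord j) _; rewrite prednK // lt0n size_eq0. Qed.

Definition passage (j : edge P) : pvisit := nth (0, false) P j.
Definition place (v : pvisit) : edge P := inord (index v P).

Lemma onth_passage (j : edge P) : onth P j = Some (passage j).
Proof. by rewrite onthE (nth_map (0, false)) // lt_size. Qed.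

Lemma passage_mem (j : edge P) : passage j \in P.
Proof. by rewrite mem_nth // lt_size. Qed.

Lemma placeK v : v \in P -> passage (place v) = v.
Proof.
by move=> vP; rewrite /passage /place inordK ?nth_index // -/N -sizeP index_mem.
Qed.

Lemma passageK (j : edge P) : place (passage j) = j.
Proof.
apply: val_inj; rewrite /= /place inordK ?index_uniq ?well_paired_uniq ?lt_size //.
Qed.

Definition other (j : edge P) : edge P := place (pmate (passage j)).

Lemma face_stepE (e : dart P) : face_step e =
  if (passage (dart_head e)).2 == e.2 then (other (dart_head e), true)
  else (ord_pred (other (dart_head e)), false).
Proof. by rewrite /face_step onth_passage. Qed.

Lemma other_passage (j : edge P) : passage (other j) = pmate (passage j).
Proof. by rewrite placeK // mem_pmate // passage_mem. Qed.

Lemma otherK : involutive other.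
Proof. by move=> j; rewrite {1}/other other_passage pmateK passageK. Qed.

Lemma face_step_inj : injective (@face_step P).
Proof.
have oI := inv_inj otherK.
have head_inj (e f : dart P) : dart_head e = dart_head f -> e.2 = f.2 -> e = f.
  case: e f => [j b] [j' b']; rewrite /dart_head /= => + bb; rewrite -{}bb.
  by case: b => [h|->] //; rewrite (ordS_inj h).
move=> e f; rewrite !face_stepE => ef; suff [] : dart_head e = dart_head f /\ e.2 = f.2.
  exact: head_inj.
move: ef; case: ifP => h1; case: ifP => h2 //.
  by move=> /(congr1 fst)/oI h; split=> //; rewrite -(eqP h1) -(eqP h2) h.
move=> /(congr1 fst)/(@ord_pred_inj _ _ _)/oI h; split=> //.
by move: h1 h2; rewrite h; case: (passage _).2; case: e.2; case: f.2.
Qed.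

Definition coherent (k : colouring) : Prop :=
  forall j : edge P, before k (passage (ordS j)) = after k (passage j).

Lemma traverses_path k i v s o : traverses k i (v :: s) o =
  [&& before k v == i, path (fun u w => before k w == after k u) v s
    & after k (last v s) == o].
Proof.
elim: s v i => [|w s IH] v i; first by [].
rewrite [LHS]/= -/(traverses k (after k v) (w :: s) o) IH /=.
by rewrite -!andbA.
Qed.

(** The cyclic condition [traverses k i P i] amounts to one condition per edge, which
    is the form that can be compared with functions on the darts. *)
Lemma coherentP k i :
  traverses k i P i <-> i = before k (passage ord0) /\ coherent k.
Proof.
have [v [s Pvs]] : exists v, exists s, P = v :: s by case: P P0 => // v s; exists v, s.
have NE : N = (size s).+1 by rewrite -sizeP Pvs.
have passE (j : edge P) : passage j = nth (0, false) (v :: s) (val j).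
  by rewrite /passage; congr nth.
have p0 : passage ord0 = v by rewrite passE.
rewrite p0 {1}Pvs traverses_path.
suff cyc : path (fun u w => before k w == after k u) v (rcons s v) <-> coherent k.
  split=> [/and3P[/eqP<- p l]|[-> /cyc]].
    by split=> //; apply/cyc; rewrite rcons_path p eq_sym.
  by rewrite rcons_path eqxx eq_sym.
have szP : size P = (size s).+1 by rewrite Pvs.
have ltj (j : edge P) : val j < (size s).+1 by rewrite -szP lt_size.
have valS (j : edge P) : val (ordS j) = (val j).+1 %% (size s).+1.
  by apply: (congr1 (modn (val j).+1)).
have nth_j (j : edge P) : nth (0, false) (v :: rcons s v) (val j) = passage j.
  by rewrite passE -rcons_cons nth_rcons ltj.
have nth_Sj (j : edge P) : nth (0, false) (rcons s v) (val j) = passage (ordS j).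
  rewrite passE nth_rcons valS.
  have := ltj j; rewrite ltnS leq_eqVlt => /orP[/eqP->|js].
    by rewrite ltnn eqxx modnn.
  by rewrite js modn_small ?ltnS.
split=> [/(pathP (0, false)) cy j|co].
  by have := cy (val j); rewrite size_rcons nth_Sj nth_j => /(_ (ltj j))/eqP.
apply/(pathP (0, false)) => j; rewrite size_rcons => js.
have jN : j < N by rewrite NE.
have := co (Ordinal jN); rewrite -nth_Sj -nth_j /= => ->; exact: eqxx.
Qed.

End Faces.

(** * Sphericity is an abundance of colourings *)

Section Count.
Variable P : projection_code.
Hypotheses (wP : well_paired P) (P0 : P != [::]).

Definition region (e : dart P) : {set dart P} :=
  [set e' | fconnect (@face_step P) e e'].

Definition face_functions : {set {ffun dart P -> bool}} :=
  [set f : {ffun dart P -> bool} | [forall e, f (face_step e) == f e]].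

Let conn_sym := fconnect_sym (face_step_inj wP P0).

Lemma eq_region e e' : (region e == region e') = fconnect (@face_step P) e e'.
Proof.
apply/eqP/idP => [/setP/(_ e')|ee']; first by rewrite !inE connect0.
by apply/setP=> f; rewrite !inE (same_connect conn_sym ee').
Qed.

Lemma face_function_connect f e e' : f \in face_functions ->
  fconnect (@face_step P) e e' -> f e = f e'.
Proof.
rewrite inE => /forallP fI /iter_findex <-.
by elim: (findex _ _ _) => //= n ->; rewrite (eqP (fI _)).
Qed.

(** The functions on the darts that are constant along [face_step] are the
    indicator functions of sets of regions. *)
Lemma card_face_functions : #|face_functions| = 2 ^ #|regions P|.
Proof.
pose g (X : {set {set dart P}}) := [ffun e => region e \in X] : {ffun dart P -> bool}.
have -> : face_functions = g @: powerset (regions P).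
  apply/setP=> f; apply/idP/imsetP => [fI|[X _ ->]].
    exists [set region e | e in [set e | f e]].
      by rewrite inE; apply/subsetP=> R /imsetP[e _ ->]; apply/imsetP; exists e.
    apply/ffunP => e; rewrite ffunE; apply/idP/imsetP => [fe|[e']].
      by exists e; rewrite ?inE.
    by rewrite inE => fe' /eqP; rewrite eq_region => /(face_function_connect fI)->.
  rewrite inE; apply/forallP=> e; rewrite !ffunE; apply/eqP; congr (_ \in X).
  by apply/eqP; rewrite eq_region conn_sym fconnect1.
rewrite card_in_imset ?card_powerset // => X Y; rewrite !inE => XR YR gXY.
have E e : (region e \in X) = (region e \in Y) by move/ffunP/(_ e): gXY; rewrite !ffunE.
apply/setP=> R; apply/idP/idP => RX.
  by have /imsetP[e _ Re] := subsetP XR R RX; rewrite Re E in RX *.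
by have /imsetP[e _ Re] := subsetP YR R RX; rewrite Re E in RX *.
Qed.

Definition corner_values (f : dart P -> bool) : colouring := fun x =>
  let j := place P (x, true) in
  ((f (ord_pred j, true), f (j, true)), (f (ord_pred j, false), f (j, false))).

Lemma corner_valuesP f : f \in face_functions -> forall j : edge P,
  before (corner_values f) (passage j) = (f (ord_pred j, true), f (ord_pred j, false))
  /\ after (corner_values f) (passage j) = (f (j, true), f (j, false)).
Proof.
rewrite inE => /forallP fI j; rewrite /before /after /corner_values.
have jE := passageK wP P0 j; set v := passage j in jE *.
have [s|s] := boolP v.2.
  by rewrite -[place _ _]/(place P (v.1, true)) (_ : (v.1, true) = v) ?jE //; case: (v) s => x [].
have vE : pmate v = (v.1, true) by case: (v) s => x [].
rewrite -vE -/(other j).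
have oE : passage (other j) = (v.1, true) by rewrite other_passage // -/v vE.
have ooE : other (other j) = j by rewrite (otherK wP P0).
have dS (i : edge P) : dart_head ((ord_pred i, true) : dart P) = i.
  by rewrite /dart_head /= ord_predK.
have fs := face_stepE P0.
have h1 : f (ord_pred (other j), true) = f (j, true).
  have := fI (ord_pred (other j), true); rewrite fs dS oE /= ooE.
  by move/eqP.
have h2 : f (j, false) = f (other j, true).
  have := fI (j, false); rewrite fs /dart_head /= -/v (negbTE s) /=.
  by move/eqP.
have h3 : f (ord_pred j, true) = f (ord_pred (other j), false).
  have := fI (ord_pred j, true); rewrite fs dS -/v (negbTE s) /=.
  by move/eqP.
have h4 : f (other j, false) = f (ord_pred j, false).
  have := fI (other j, false); rewrite fs /dart_head /= oE /= ooE.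
  by move/eqP.
by rewrite h1 h2 h3 h4.
Qed.

Definition dart_values (k : colouring) : {ffun dart P -> bool} :=
  [ffun e : dart P => let a := after k (passage e.1) in if e.2 then a.1 else a.2].

Lemma dart_valuesP k : coherent P k -> dart_values k \in face_functions.
Proof.
move=> co; have co' (i : edge P) : after k (passage (ord_pred i)) = before k (passage i).
  by rewrite -co ord_predK.
rewrite inE; apply/forallP=> -[j b]; apply/eqP.
rewrite face_stepE // /dart_values !ffunE /dart_head; case: b => /=.
  rewrite -(co j); case s: (passage (ordS j)).2 => /=; rewrite ?co' other_passage //;
  by rewrite /before /after /pmate /= s; case: (k _) => [[? ?] [? ?]].
case s: (passage j).2 => /=; rewrite ?co' other_passage //;
by rewrite /before /after /pmate /= s; case: (k _) => [[? ?] [? ?]].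
Qed.

Lemma corner_values_coherent f : f \in face_functions -> coherent P (corner_values f).
Proof.
move=> /corner_valuesP fE j.
by rewrite (proj1 (fE _)) (proj2 (fE _)) ordSK.
Qed.

Lemma mem_strand x b : x \in map fst P -> (x, b) \in P.
Proof.
case/mapP=> -[y s] vP /= ->; have := mem_pmate wP vP; rewrite /pmate /=.
by move: vP; case: b; case: s.
Qed.

Lemma corner_valuesK k x : coherent P k -> x \in map fst P ->
  corner_values (dart_values k) x = k x.
Proof.
move=> co /(mem_strand true) xP; rewrite /corner_values /dart_values !ffunE /=.
rewrite -!co ord_predK co placeK // /before /after /=.
by case: (k x) => [[? ?] [? ?]].
Qed.

Let first_edge : edge P := ord_pred ord0.

Lemma edge_ind (Q : edge P -> Prop) :
  Q first_edge -> (forall j, Q j -> Q (ordS j)) -> forall j, Q j.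
Proof.
move=> Q0 QS [j jP]; elim: j jP => [|j IH] jP.
  have -> : Ordinal jP = ordS first_edge by rewrite ord_predK; apply: val_inj.
  exact: QS.
have jP' := ltnW jP; have -> : Ordinal jP = ordS (Ordinal jP').
  by apply: val_inj; rewrite /= modn_small.
exact/QS/IH.
Qed.

(** Without flow the function takes the same value on both sides of every edge,
    hence at the four corners of every crossing, and the curve is connected. *)
Lemma trivial_face_function h : h \in face_functions ->
    (forall x, x \in map fst P -> jump (corner_values h x) = false) ->
    h (first_edge, true) = false -> h (first_edge, false) = false ->
  forall e, h e = false.
Proof.
move=> hI hj ht hf; have hE := corner_valuesP hI.
have flow0 (j : edge P) : h (j, true) = h (j, false).
  apply: (edge_ind (Q := fun j => h (j, true) = h (j, false))) => [|{}j jE].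
    by rewrite ht hf.
  have := flow_after (corner_values h) (passage (ordS j)).
  rewrite (proj1 (hE _)) (proj2 (hE _)) ordSK hj ?map_f ?passage_mem // /flow /= jE.
  by rewrite addbb; case: (h _); case: (h _).
suff val0 (j : edge P) : h (j, true) = false by case=> j []; rewrite -?flow0 val0.
apply: (edge_ind (Q := fun j => h (j, true) = false)) => // {}j jE.
have [b0 a0] := hE (ordS j); have [b1 a1] := hE (other (ordS j)).
move: b0 a0 b1 a1; rewrite ordSK -!flow0 jE other_passage // /before /after.
move: (corner_values h) => k; rewrite /pmate /=.
by case: (k _) => [[? ?] [? ?]]; case: (passage _).2 => /=; congruence.
Qed.

Definition weights (f : {ffun dart P -> bool}) :
    {ffun 'I_(crossing_number P) -> bool} * bool * bool :=
  ([ffun i => jump (corner_values f (nth 0 (crossings P) (val i)))],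
   f (first_edge, true) (+) f (first_edge, false), f (first_edge, true)).

Lemma nth_crossings x : x \in map fst P ->
  exists i : 'I_(crossing_number P), nth 0 (crossings P) (val i) = x.
Proof.
move=> xP; have xc : x \in crossings P by rewrite mem_undup.
have ic : index x (crossings P) < crossing_number P by rewrite index_mem.
by exists (Ordinal ic); rewrite /= nth_index.
Qed.

Lemma weights_inj : {in face_functions &, injective weights}.
Proof.
move=> f g fI gI [/ffunP ej ez et].
pose h := [ffun e => f e (+) g e] : {ffun dart P -> bool}.
have hI : h \in face_functions.
  move: fI gI; rewrite !inE => /forallP fI /forallP gI; apply/forallP=> e.
  by rewrite !ffunE (eqP (fI e)) (eqP (gI e)).
suff h0 e : h e = false.
  by apply/ffunP=> e; have /eqP := h0 e; rewrite ffunE addbC; case: (f e) (g e) => [] [].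
apply: trivial_face_function hI _ _ _ e => [x /nth_crossings[i <-]||].
- have := ej i; rewrite !ffunE /corner_values /jump /= !ffunE => E.
  move: E; do 8 case: (_ (_, _)) => //.
- by rewrite ffunE et addbb.
- by rewrite ffunE; move: ez; rewrite et; case: (g _) (f _) (g _) => [] [] [].
Qed.

Let card_weights : #|[set: {ffun 'I_(crossing_number P) -> bool} * bool * bool]|
  = 2 ^ (crossing_number P + 2).
Proof.
by rewrite cardsT !card_prod card_ffun card_bool card_ord expnD -mulnA.
Qed.

(** There are 2 ^ F face functions for F regions, and [weights] embeds them into
    a set with 2 ^ (n + 2) elements: F is at most n + 2, with equality exactly
    when every flow comes from a face function. *)
Lemma spherical_weights :
  spherical P = (weights @: face_functions == setT).
Proof.
rewrite /spherical -(inj_eq (@expnI 2 isT)) -card_face_functions -card_weights.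
rewrite -(card_in_imset weights_inj).
by rewrite eqEcard subsetT /= eqn_leq (subset_leq_card (subsetT _)).
Qed.

Lemma jump_shift c nw ne sw se :
  jump ((nw (+) c, ne (+) c), (sw (+) c, se (+) c)) = jump ((nw, ne), (sw, se)).
Proof. by rewrite /jump /=; case: c nw ne sw se => [] [] [] [] []. Qed.

(** Euler's formula becomes a condition that is local on the code, hence easy to
    follow through the moves, and that yields separation statements of the
    Jordan type when it is applied to well-chosen flows. *)
Lemma sphericalP : spherical P <-> colourable P.
Proof.
rewrite spherical_weights; split=> [/eqP sph eps z|col].
  pose w := [ffun i : 'I_(crossing_number P) => eps (nth 0 (crossings P) (val i))].
  have : (w, z, false) \in weights @: face_functions by rewrite sph inE.
  case/imsetP=> f fI [/ffunP wE zE _].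
  exists (corner_values f), (before (corner_values f) (passage (ord0 : edge P))); split.
  - by move=> x /nth_crossings[i <-]; have := wE i; rewrite !ffunE.
  - by apply/coherentP => //; split=> //; apply: corner_values_coherent.
  - by rewrite zE (proj1 (corner_valuesP fI ord0)).
rewrite eqEsubset subsetT; apply/subsetP=> -[[w z] b] _.
pose eps x := if insub (index x (crossings P)) is Some i then w i else false.
have [k [i [kj /coherentP-/(_ P0)[ik co] fl]]] := col eps z.
pose c := (before k (passage (ord0 : edge P))).1 (+) b.
pose k' x : corners := let: ((nw, ne), (sw, se)) := k x in
  ((nw (+) c, ne (+) c), (sw (+) c, se (+) c)).
have k'before v : before k' v = ((before k v).1 (+) c, (before k v).2 (+) c).
  by rewrite /before /k'; case: (k v.1) => [[? ?] [? ?]]; case: v.2.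
have k'after v : after k' v = ((after k v).1 (+) c, (after k v).2 (+) c).
  by rewrite /after /k'; case: (k v.1) => [[? ?] [? ?]]; case: v.2.
have co' : coherent P k' by move=> j; rewrite k'before k'after co.
apply/imsetP; exists (dart_values k'); first exact: dart_valuesP.
congr (_, _, _).
- apply/ffunP=> j; rewrite ffunE.
  have jP : nth 0 (crossings P) (val j) \in map fst P by rewrite -mem_undup;
  apply: (@mem_nth _ 0 (crossings P)); apply: ltn_ord.
  rewrite corner_valuesK // /k'; case E: (k _) => [[? ?] [? ?]]; rewrite jump_shift -E kj //.
  rewrite /eps (_ : index _ _ = val j); last by rewrite index_uniq ?undup_uniq //; apply: ltn_ord.
  case: insubP => [l _ lj|]; last by rewrite ltn_ord.
  by congr (w _); apply: val_inj.
- rewrite !ffunE /= -co' ord_predK k'before -fl ik /flow /=.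
  by case: (before _ _) => [[] []]; case: (c).
- by rewrite !ffunE /= -co' ord_predK k'before /c /=; case: (before _ _).1; case: (b).
Qed.

End Count.

Notation plain v := (label v, side v).

Lemma map_fst_shadow D : map fst (shadow D) = map label D.
Proof. by rewrite /shadow -map_comp. Qed.

(** A colouring may be checked passage by passage when every passage is
    replaced by a path with the same ends. *)
Lemma traverses_expand (T : eqType) (g : T -> pvisit) (h : T -> seq pvisit) k k' i s o :
    traverses k i (map g s) o ->
    {in s, forall v, traverses k' (before k (g v)) (h v) (after k (g v))} ->
  traverses k' i (flatten (map h s)) o.
Proof.
elim: s i => [|v s IH] i //= /andP[/eqP<- tr] loc; apply/traverses_cat.
exists (after k (g v)); first by apply: loc; rewrite mem_head.
by apply: IH => // w ws; apply: loc; rewrite inE ws orbT.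
Qed.

Lemma colourable_bigon u v o A B :
    side u = ~~ side v -> label u \notin map label (A ++ B) ->
    label v \notin map label (A ++ B) ->
    colourable (shadow ([:: u; v] ++ A ++ strand o (mate u) (mate v) ++ B)) ->
  colourable (shadow (A ++ B)).
Proof.
move=> suv uAB vAB col eps z.
pose eps' x := if (x == label u) || (x == label v) then false else eps x.
have [k [i [e tr fl]]] := col eps' z.
exists k, i; split=> //.
  move=> x xAB; rewrite e ?/eps'.
    have labAB: x \in map label (A ++ B).
      by move: xAB; rewrite /shadow -map_comp.
    by case: eqP => [xu|_]; [rewrite xu (negbTE uAB) in labAB|];
      case: eqP => [xv|_] //; rewrite xv (negbTE vAB) in labAB.
  move: xAB; rewrite /shadow !map_cat !mem_cat.
  by case/orP=> ->; rewrite !orbT.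
move: tr; rewrite /shadow !map_cat => /traverses_cat[m t1 /traverses_cat[n t2 /traverses_cat[j t3 t4]]].
have ju: jump (k (label u)) = false.
  by rewrite e /eps' ?eqxx // inE eqxx.
have jv: jump (k (label v)) = false.
  by rewrite e /eps' ?eqxx ?orbT // !inE eqxx orbT.
have t3': traverses k n (if o then [:: (label u, ~~ side u); (label v, side u)]
                    else [:: (label v, side u); (label u, ~~ side u)]) j.
  by move: t3; rewrite suv; case: (o); rewrite /= ?suv ?negbK.
have t1': traverses k i [:: (label u, side u); (label v, ~~ side u)] m.
  by move: t1; rewrite /= suv !negbK.
have [im nj] := traverses_bigon ju jv t1' t3'; subst m j.
by apply/traverses_cat; exists n.
Qed.

Definition expand (f : visit -> seq visit) (s : diagram_code) : diagram_code :=
  flatten (map f s).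

(** The corners of a crossing from the edges [e] before and [f] after the
    passage of bit [s]. *)
Definition crossing_corners (s : bool) (e f : bool * bool) : corners :=
  if s then ((e.1, f.1), (e.2, f.2)) else (f, e).

Arguments crossing_corners : simpl never.

Lemma corners_before_after k (v : pvisit) :
  k v.1 = crossing_corners v.2 (before k v) (after k v).
Proof.
by rewrite /crossing_corners /before /after; case: (k v.1) => [[? ?] [? ?]]; case: v.2.
Qed.

Lemma jump_corners s e f : jump (crossing_corners s e f) = flow e (+) flow f.
Proof.
case: e f => [l r] [l' r']; rewrite /jump /flow; case: s => /=; last by rewrite addbC.
by rewrite addbACA.
Qed.

Lemma corners_sides k x s e f : k x = crossing_corners s e f ->
  [/\ before k (x, s) = e, after k (x, s) = f,
     before k (x, ~~ s) = (if s then (e.2, f.2) else (f.1, e.1))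
   & after k (x, ~~ s) = (if s then (e.1, f.1) else (f.2, e.2))].
Proof.
by case: e f => [? ?] [? ?]; rewrite /before /after => /= ->; case: s.
Qed.

Section Swap.
Variables (p q : visit) (a b : nat).

Let w1 := Visit a Weld (side p == side q).
Let w2 := Visit b Weld (side p != side q).

(** The strands crossing the two consecutive passages [p] and [q] are pushed
    across each other on the left of the edge between them, which creates the
    welded crossings [w1] and [w2], [w1] being next to that edge. *)
Definition bigon_expansion (v : visit) : seq visit :=
  if v == mate p then if side p then [:: v; w1; w2] else [:: w2; w1; v]
  else if v == mate q then
    if side q then [:: v; mate w1; mate w2] else [:: mate w2; mate w1; v]
  else [:: v].

(** The same after the strand through [p] and [q] has been slid across [w1]. *)
Definition swap_expansion (v : visit) : seq visit :=
  if v == mate p then if side p then [:: w1; v; w2] else [:: w2; v; w1]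
  else if v == mate q then
    if side q then [:: mate w1; v; mate w2] else [:: mate w2; v; mate w1]
  else [:: v].

Variable E : diagram_code.
Hypotheses (pq : label p != label q) (ab : a != b).
Hypotheses (Ep : {in E, forall v, label v = label p -> v = mate p}).
Hypotheses (Eq : {in E, forall v, label v = label q -> v = mate q}).
Hypotheses (Ea : a \notin map label [:: p, q & E]).
Hypotheses (Eb : b \notin map label [:: p, q & E]).

Let mate_eqF v w : label v != label w -> (v == mate w) = false.
Proof. by move=> ne; apply/eqP => vw; rewrite vw eqxx in ne. Qed.

(** A local modification of the curve inside a disc.  Outside the disc the new
    flow restricts to a flow of the old curve, for which the jumps at [p] and
    [q] absorb those at the two new crossings; it remains to fill the disc with
    corner values. *)
Lemma patch_colourable (f : visit -> seq visit) (r : seq visit) :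
    (forall v, v != mate p -> v != mate q -> f v = [:: v]) ->
    (forall v, {subset map label (f v) <= [:: label v; a; b]}) ->
    {subset map label r <= [:: label p; label q]} ->
    (forall (k : colouring) (eps : nat -> bool),
       jump (k (label p)) = eps (label p) (+) (eps a (+) eps b) ->
       jump (k (label q)) = eps (label q) (+) (eps a (+) eps b) ->
       after k (plain p) = before k (plain q) ->
       exists k' : colouring,
         [/\ forall x, x \notin [:: label p; label q; a; b] -> k' x = k x,
            forall x, x \in [:: label p; label q; a; b] -> jump (k' x) = eps x,
            traverses k' (before k (plain p)) (shadow r) (after k (plain q)),
            traverses k' (before k (plain (mate p))) (shadow (f (mate p)))
              (after k (plain (mate p)))
          & traverses k' (before k (plain (mate q))) (shadow (f (mate q)))
              (after k (plain (mate q)))]) ->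
  colourable (shadow [:: p, q & E]) -> colourable (shadow (r ++ expand f E)).
Proof.
move=> f1 flab rlab loc col eps z.
pose d := eps a (+) eps b.
pose eps' x := eps x (+) ((x == label p) || (x == label q)) && d.
have [k [i [e /= /and3P[/eqP pi /eqP pq' tr] fl]]] := col eps' z.
have ep x : x \in [:: label p; label q] -> jump (k x) = eps x (+) d.
  rewrite !inE => xpq; rewrite e ?map_fst_shadow /eps' ?xpq //.
  by rewrite !inE orbA xpq.
have [|||k' [out inn tr_r tr_p tr_q]] := loc k eps.
- by apply: ep; rewrite inE eqxx.
- by apply: ep; rewrite !inE eqxx orbT.
- by rewrite pq'.
exists k', i; split=> //.
- move=> x xin; have [/inn//|xn] := boolP (x \in [:: label p; label q; a; b]).
  rewrite out // e ?map_fst_shadow /eps'.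
    by move: xn; rewrite !inE !negb_or => /and4P[/negbTE-> /negbTE-> _ _] /=; rewrite addbF.
  move: xin; rewrite map_fst_shadow map_cat mem_cat => /orP[/mapP[v vr ->]|].
    have /rlab : label v \in map label r by apply: map_f.
    by rewrite /= !inE => /orP[]->; rewrite ?orbT.
  case/mapP=> v /flatten_mapP[w wE vw] xv; subst x.
  have /flab : label v \in map label (f w) by apply: map_f.
  move: xn; rewrite !inE /= !negb_or => /and4P[_ _ /negbTE-> /negbTE->]; rewrite !orbF.
  by move=> /eqP->; apply/orP; right; apply/orP; right; apply: map_f.
- rewrite /shadow map_cat; apply/traverses_cat; exists (after k (plain q)).
    by rewrite -pi.
  rewrite map_flatten -map_comp; apply: traverses_expand tr _ => v vE.
  have [->|vp] := eqVneq v (mate p) => //.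
  have [->|vq] := eqVneq v (mate q) => //.
  rewrite /= (f1 _ vp vq) /= /before /after /= out ?eqxx //.
  rewrite !inE !negb_or; apply/and4P; split.
  - by apply: contraNneq vp => /Ep->.
  - by apply: contraNneq vq => /Eq->.
  - by apply: contraNneq Ea => <-; rewrite !inE map_f ?orbT.
  - by apply: contraNneq Eb => <-; rewrite !inE map_f ?orbT.
Qed.

Let labels_neq : uniq [:: label p; label q; a; b].
Proof.
move: Ea Eb; rewrite /= !inE !negb_or => /and3P[ap aq _] /and3P[bp bq _].
by rewrite pq ab eq_sym ap eq_sym bp eq_sym aq eq_sym bq.
Qed.

Let set4 (c1 c2 c3 c4 : corners) (k : colouring) : colouring := fun x =>
  if x == label p then c1 else if x == label q then c2
  else if x == a then c3 else if x == b then c4 else k x.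

Let set4E c1 c2 c3 c4 k (k' := set4 c1 c2 c3 c4 k) :
  [/\ k' (label p) = c1, k' (label q) = c2, k' a = c3, k' b = c4
    & forall x, x \notin [:: label p; label q; a; b] -> k' x = k x].
Proof.
move: labels_neq; rewrite /= !inE !negb_or !andbT -!andbA.
case/and5P=> h1 h2 h3 h4 /andP[h5 h6]; rewrite /k' /set4 !eqxx.
rewrite [label q == _]eq_sym [a == _]eq_sym [b == _]eq_sym.
rewrite [a == label q]eq_sym [b == label q]eq_sym [b == a]eq_sym.
rewrite !(negbTE h1, negbTE h2, negbTE h3, negbTE h4, negbTE h5, negbTE h6).
split=> // x; rewrite !inE !negb_or.
by case/and4P=> /negbTE-> /negbTE-> /negbTE-> /negbTE->.
Qed.

Lemma bigon_colourable :
  colourable (shadow [:: p, q & E]) ->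
  colourable (shadow ([:: p; q] ++ expand bigon_expansion E)).
Proof.
apply: patch_colourable => [v vp vq|v|//|k eps jp jq pqk].
- by rewrite /bigon_expansion (negbTE vp) (negbTE vq).
- rewrite /bigon_expansion; case: eqP => [->|_]; [case: (side p)|case: eqP => [->|_];
  [case: (side q)|]];
  by move=> x; rewrite !inE //; first [case/or3P=> ->; rewrite ?orbT | move=> ->].
have := corners_before_after k (plain p); have := corners_before_after k (plain q).
rewrite pqk /=; case: (before k _) (before k _) (after k _) => [l0 r0] [l1 r1] [l2 r2].
move=> kq kp; rewrite kp jump_corners in jp; rewrite kq jump_corners in jq.
have {kp}[_ _ -> ->] := corners_sides kp; have {kq}[_ _ -> ->] := corners_sides kq.
(* [l0] and [l2] are the regions beside the two strands, [l1] is the region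
   beyond the bigon, [g] is the new bigon and [t] the new triangle. *)
pose g := eps b (+) l0 (+) l2 (+) l1; pose t := eps a (+) l0 (+) l2 (+) g.
have [] := set4E (crossing_corners (side p) (l0, r0) (t, r1))
  (crossing_corners (side q) (t, r1) (l2, r2))
  (if side p then crossing_corners (side w1) (l0, t) (g, l2)
   else crossing_corners (side w1) (l2, g) (t, l0))
  (if side p then crossing_corners (side w2) (g, l2) (l0, l1)
   else crossing_corners (side w2) (l1, l0) (l2, g)) k.
set k' := set4 _ _ _ _ _ => kp kq ka kb kx; exists k'.
have pqF : (mate q == mate p) = false by rewrite mate_eqF // eq_sym.
rewrite /bigon_expansion pqF !eqxx; split; first exact: kx.
- have tE : t = l1 (+) (eps a (+) eps b).
    by rewrite /t /g; case: (l0) (l1) (l2) (eps a) (eps b) => [] [] [] [] [].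
  move=> x; rewrite !inE => /or4P[]/eqP->; rewrite ?(kp, kq, ka, kb).
  - rewrite jump_corners tE -[RHS](addbK (eps a (+) eps b)) -jp /flow /=;
    move: (eps a (+) eps b) => d.
    by case: (l0) (r0) (l1) (r1) (d) => [] [] [] [] [].
  - rewrite jump_corners tE -[RHS](addbK (eps a (+) eps b)) -jq /flow /=;
    move: (eps a (+) eps b) => d.
    by case: (l2) (r2) (l1) (r1) (d) => [] [] [] [] [].
  - case: (side p); rewrite jump_corners /flow /t /=;
    by case: (l0) (g) (l2) (eps a) => [] [] [] [].
  - case: (side p); rewrite jump_corners /flow /g /=;
    by case: (l0) (l1) (l2) (eps b) => [] [] [] [].
- have [be af _ _] := corners_sides kp; have [be' af' _ _] := corners_sides kq.
  by rewrite /= be af be' af' !eqxx.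
- have [_ _ be af] := corners_sides kp.
  move: ka kb be af; rewrite /mate /w1 /w2; case: (side p) => /= ka kb be af;
  have [be1 af1 _ _] := corners_sides ka; have [be2 af2 _ _] := corners_sides kb;
  by rewrite be af be1 af1 be2 af2 !eqxx.
- have [_ _ be af] := corners_sides kq.
  move: ka kb be af; rewrite /mate /w1 /w2; case: (side p); case: (side q) => /= ka kb be af;
  have [_ _ be1 af1] := corners_sides ka; have [_ _ be2 af2] := corners_sides kb;
  by rewrite be af be1 af1 be2 af2 !eqxx.
Qed.
Lemma swap_colourable :
  colourable (shadow [:: p, q & E]) ->
  colourable (shadow ([:: q; p] ++ expand swap_expansion E)).
Proof.
apply: patch_colourable => [v vp vq|v|x|k eps jp jq pqk].
- by rewrite /swap_expansion (negbTE vp) (negbTE vq).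
- rewrite /swap_expansion; case: eqP => [->|_]; [case: (side p)|case: eqP => [->|_];
  [case: (side q)|]];
  by move=> x; rewrite !inE //; first [case/or3P=> ->; rewrite ?orbT | move=> ->].
- by rewrite !inE orbC.
have := corners_before_after k (plain p); have := corners_before_after k (plain q).
rewrite pqk /=; case: (before k _) (before k _) (after k _) => [l0 r0] [l1 r1] [l2 r2].
move=> kq kp; rewrite kp jump_corners in jp; rewrite kq jump_corners in jq.
have {kp}[_ _ -> ->] := corners_sides kp; have {kq}[_ _ -> ->] := corners_sides kq.
(* The triangle [t] now lies on the other side of [w1], whose remaining corners
   are the regions [r0], [r1], [r2] on the right of the strand. *)
pose g := eps b (+) l0 (+) l2 (+) l1; pose t := eps a (+) r0 (+) r2 (+) r1.
have [] := set4E (crossing_corners (side p) (g, t) (l2, r2))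
  (crossing_corners (side q) (l0, r0) (g, t))
  (if side p then crossing_corners (side w1) (r0, r1) (t, r2)
   else crossing_corners (side w1) (r2, t) (r1, r0))
  (if side p then crossing_corners (side w2) (g, l2) (l0, l1)
   else crossing_corners (side w2) (l1, l0) (l2, g)) k.
set k' := set4 _ _ _ _ _ => kp kq ka kb kx; exists k'.
have pqF : (mate q == mate p) = false by rewrite mate_eqF // eq_sym.
rewrite /swap_expansion pqF !eqxx; split; first exact: kx.
- have gtE : g (+) t = (eps a (+) eps b) (+) (l0 (+) r0 (+) (l1 (+) r1) (+) (l2 (+) r2)).
    rewrite /t /g; case: (eps a); case: (eps b);
    by case: (l0) (l1) (l2) (r0) (r1) (r2) => [] [] [] [] [] [].
  move=> x; rewrite !inE => /or4P[]/eqP->; rewrite ?(kp, kq, ka, kb).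
  - rewrite jump_corners -[RHS](addbK (eps a (+) eps b)) -jp /flow /= gtE.
    move: (eps a (+) eps b) => d.
    by case: (l0) (r0) (l1) (r1) (l2) (r2) (d) => [] [] [] [] [] [] [].
  - rewrite jump_corners -[RHS](addbK (eps a (+) eps b)) -jq /flow /= gtE.
    move: (eps a (+) eps b) => d.
    by case: (l0) (r0) (l1) (r1) (l2) (r2) (d) => [] [] [] [] [] [] [].
  - case: (side p); rewrite jump_corners /flow /t /=;
    by case: (r0) (r1) (r2) (eps a) => [] [] [] [].
  - case: (side p); rewrite jump_corners /flow /g /=;
    by case: (l0) (l1) (l2) (eps b) => [] [] [] [].
- have [be af _ _] := corners_sides kp; have [be' af' _ _] := corners_sides kq.
  by rewrite /= be af be' af' !eqxx.
- have [_ _ be af] := corners_sides kp.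
  move: ka kb be af; rewrite /mate /w1 /w2; case: (side p) => /= ka kb be af;
  have [be1 af1 _ _] := corners_sides ka; have [be2 af2 _ _] := corners_sides kb;
  by rewrite be af be1 af1 be2 af2 !eqxx.
- have [_ _ be af] := corners_sides kq.
  move: ka kb be af; rewrite /mate /w1 /w2; case: (side p); case: (side q) => /= ka kb be af;
  have [_ _ be1 af1] := corners_sides ka; have [_ _ be2 af2] := corners_sides kb;
  by rewrite be af be1 af1 be2 af2 !eqxx.
Qed.
End Swap.

(** * Welded diagrams up to equivalence *)

Lemma mateK : involutive mate.
Proof. by case=> x [] s; rewrite /mate /= negbK. Qed.

Lemma mate_neq v : mate v != v.
Proof. by apply/eqP=> /(congr1 side) /=; case: (side v). Qed.

Lemma shadow_cat A B : shadow (A ++ B) = shadow A ++ shadow B.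
Proof. exact: map_cat. Qed.

Lemma well_formed_perm D D' : perm_eq D D' -> well_formed D = well_formed D'.
Proof.
move=> DD'; rewrite /well_formed (perm_all _ DD'); apply: eq_all => v.
by rewrite (perm_mem DD') (permP (perm_map label DD')).
Qed.

Lemma well_formed_pair v D :
  well_formed [:: v, mate v & D] = (label v \notin map label D) && well_formed D.
Proof.
apply/idP/andP => [wf|[vD wf]].
  have vD : label v \notin map label D.
    apply/count_memPn; move: wf => /= /andP[/andP[_]]; rewrite /= eqxx add1n => /eqP[] //.
  split=> //; apply/allP=> w wD.
  have lw : label w != label v by apply: contraNneq vD => <-; rewrite map_f.
  have /andP[] := allP wf w (mem_behead (s := _ :: _) (mem_behead (s := _ :: _) wD)).
  rewrite !inE => /or3P[/eqP mw|/eqP mw|->] /=.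
  - by move/(congr1 label): mw lw => /= ->; rewrite eqxx.
  - by move/(congr1 label): mw lw => /= ->; rewrite eqxx.
  by rewrite [label v == _]eq_sym (negbTE lw).
have cv : count_mem (label v) (map label D) = 0 by apply/count_memPn.
apply/allP=> w; rewrite !inE /= => /or3P[/eqP->|/eqP->|wD].
- by rewrite eqxx cv eqxx orbT.
- by rewrite mateK !eqxx cv.
have /andP[mw cw] := allP wf w wD.
have lw : label w != label v by apply: contraNneq vD => <-; rewrite map_f.
by rewrite /= ?inE mw ?orbT /= [label v == _]eq_sym (negbTE lw).
Qed.

Lemma well_formed_paired D : well_formed D -> well_paired (shadow D).
Proof.
move=> wf; rewrite /well_paired all_map; apply/allP=> v vD /=.
have /andP[mv c] := allP wf v vD.
by rewrite map_fst_shadow c andbT; apply/mapP; exists (mate v).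
Qed.

Lemma well_formed_uniq D : well_formed D -> uniq D.
Proof.
by move/well_formed_paired/well_paired_uniq; rewrite /shadow => /map_uniq.
Qed.

Lemma well_formed_mate D v : well_formed D -> v \in D -> mate v \in D.
Proof. by move=> wf /(allP wf)/andP[]. Qed.

Lemma well_formed_split v E : well_formed (v :: E) ->
  exists A B, [/\ E = A ++ mate v :: B, label v \notin map label (A ++ B)
    & well_formed (A ++ B)].
Proof.
move=> wf; have : mate v \in E.
  by have := well_formed_mate wf (mem_head _ _); rewrite inE (negbTE (mate_neq v)).
move=> vE; case/splitPr: vE wf => A B wf.
exists A, B; have pe : perm_eq (v :: A ++ mate v :: B) [:: v, mate v & A ++ B].
  by rewrite perm_cons (perm_catCA A [:: mate v] B).
by move: wf; rewrite (well_formed_perm pe) well_formed_pair => /andP[].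
Qed.

Lemma well_formed_unique v E : well_formed (v :: E) ->
  {in E, forall w, label w = label v -> w = mate v}.
Proof.
case/well_formed_split=> A [B [-> vAB _]] w; rewrite mem_cat inE.
case/or3P=> [wA|/eqP->//|wB] wv; case/negP: vAB; rewrite -wv map_f //.
  by rewrite mem_cat wA.
by rewrite mem_cat wB orbT.
Qed.

Lemma spherical_nil : spherical [::].
Proof.
rewrite /spherical /regions card_imset.
  by rewrite card_prod card_ord card_bool.
have fix_e : forall e : dart [::], face_step e = e by move=> e; rewrite /face_step;
  case: (dart_head e) => [[|[]]].
move=> e e' /setP/(_ e'); rewrite !inE connect0 => /iter_findex <-.
by elim: (findex _ _ _) => //= n <-; rewrite fix_e.
Qed.

(** The form in which all the moves below are checked. *)
Lemma welded_diagramP D :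
  welded_diagram D <-> well_formed D /\ colourable (shadow D).
Proof.
rewrite /welded_diagram; have [->|D0] := eqVneq D [::].
  rewrite spherical_nil; split=> // _; split=> // eps z.
  by exists (fun _ => ((false, false), (false, false))), (z, false); split;
  rewrite //= ?eqxx // /flow /= addbF.
have S0 : shadow D != [::] by case: D D0.
split=> [/andP[wf sp]|[wf col]].
  by split=> //; apply/sphericalP => //; apply: well_formed_paired.
by rewrite wf; apply/sphericalP => //; apply: well_formed_paired.
Qed.

Lemma equiv_move D D' : welded_diagram D -> welded_diagram D' ->
  basic_move D D' -> welded_equivalent D D'.
Proof. by move=> wD wD' m; apply: rst_step. Qed.

Lemma welded_trans D2 D1 D3 : welded_equivalent D1 D2 -> welded_equivalent D2 D3 ->
  welded_equivalent D1 D3.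
Proof. exact: rst_trans. Qed.

Lemma welded_sym D1 D2 : welded_equivalent D1 D2 -> welded_equivalent D2 D1.
Proof. exact: rst_sym. Qed.

Lemma welded_diagram_rot A B : welded_diagram (A ++ B) -> welded_diagram (B ++ A).
Proof.
case/welded_diagramP=> wf col; apply/welded_diagramP; split.
  by rewrite (well_formed_perm (D' := A ++ B)) // perm_catC.
by rewrite shadow_cat; apply: colourable_rot; rewrite -shadow_cat.
Qed.

Lemma equiv_rot A B : welded_diagram (A ++ B) -> welded_equivalent (A ++ B) (B ++ A).
Proof.
move=> w; apply: equiv_move (welded_diagram_rot w) _ => //.
by rewrite -[B ++ A]rot_size_cat; apply: move_base_point.
Qed.

Lemma equiv_bigon u v o X Y Z :
    lev u = lev v -> side u = ~~ side v ->
    welded_diagram (X ++ Y ++ Z) ->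
    welded_diagram (X ++ [:: u; v] ++ Y ++ strand o (mate u) (mate v) ++ Z) ->
  welded_equivalent (X ++ Y ++ Z)
    (X ++ [:: u; v] ++ Y ++ strand o (mate u) (mate v) ++ Z).
Proof.
move=> lv sv w w'; apply: welded_trans (equiv_rot w) _.
apply: welded_sym; apply: welded_trans (equiv_rot w') _; apply: welded_sym.
move: (welded_diagram_rot w) (welded_diagram_rot w'); rewrite -!catA => r r'.
by apply: equiv_move r r' _; apply: move_r2.
Qed.

(** A strand that meets its two crossings at these levels may take part in a
    triangle move as the distinguished strand. *)
Definition passable (l l' : level) : bool := (l == l') && (l != Under).

(** The side conditions of the triangle move are invariant under cyclic
    permutation of the three strands, so any of them may be the distinguished
    one. *)
Lemma equiv_triangle a b c h op oq or A B C :
    [|| passable (lev a) (lev b), passable (lev (mate b)) (lev c)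
      | passable (lev (mate c)) (lev (mate a))] ->
    side b = h (+) (op == oq) -> side c = h (+) (oq == or) ->
    side (mate a) = h (+) (or == op) ->
  let D o1 o2 o3 := strand o1 a b ++ A ++ strand o2 (mate b) c ++ B
    ++ strand o3 (mate c) (mate a) ++ C in
  welded_diagram (D op oq or) -> welded_diagram (D (~~ op) (~~ oq) (~~ or)) ->
  welded_equivalent (D op oq or) (D (~~ op) (~~ oq) (~~ or)).
Proof.
move=> ok sb sc sa D wD wD'.
have [/andP[/eqP l1 l2]|] := boolP (passable (lev a) (lev b)).
  by apply: equiv_move => //; apply: (move_r3 (h := h)).
move=> /negbTE nab; rewrite nab /= in ok; case/orP: ok => /andP[/eqP l1 l2].
  have rotD o1 o2 o3 : D o1 o2 o3 = (strand o1 a b ++ A) ++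
    (strand o2 (mate b) c ++ B ++ strand o3 (mate c) (mate a) ++ C).
    by rewrite -catA.
  rewrite rotD in wD; rewrite rotD in wD'; rewrite !rotD.
  apply: welded_trans (equiv_rot wD) _.
  apply: welded_sym; apply: welded_trans (equiv_rot wD') _; apply: welded_sym.
  move: (welded_diagram_rot wD) (welded_diagram_rot wD'); rewrite -!catA => r r'.
  apply: equiv_move r r' _.
  have := @move_r3 (mate b) c (mate a) h oq or op B C A l1 l2 sc sa.
  by rewrite !mateK => /(_ sb).
have rotD o1 o2 o3 : D o1 o2 o3 = (strand o1 a b ++ A ++ strand o2 (mate b) c ++ B) ++
  (strand o3 (mate c) (mate a) ++ C) by rewrite -!catA.
rewrite rotD in wD; rewrite rotD in wD'; rewrite !rotD.
apply: welded_trans (equiv_rot wD) _.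
apply: welded_sym; apply: welded_trans (equiv_rot wD') _; apply: welded_sym.
move: (welded_diagram_rot wD) (welded_diagram_rot wD'); rewrite -!catA => r r'.
apply: equiv_move r r' _.
have := @move_r3 (mate c) (mate a) b h or op oq C A B l1 l2 sa sb.
by rewrite !mateK => /(_ sc).
Qed.

(** * Exchanging two consecutive passages *)

(** In the triangle formed by two consecutive passages and a new welded crossing,
    some strand must have the same level, over or welded, at its two corners. *)
Definition swappable (l l' : level) : bool :=
  [|| l == Weld, l' == Weld | (l == Over) && (l' == Over)].

Lemma expand_id f s : {in s, forall v, f v = [:: v]} -> expand f s = s.
Proof.
elim: s => //= v s IH fE; rewrite /expand /= fE ?mem_head //= -/(expand f s) IH // => w ws.
by rewrite fE // inE ws orbT.
Qed.

Lemma expand_cat f s t : expand f (s ++ t) = expand f s ++ expand f t.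
Proof. by rewrite /expand map_cat flatten_cat. Qed.

Lemma expand_cons f v t : expand f (v :: t) = f v ++ expand f t.
Proof. by []. Qed.

Ltac perm_count :=
  let P := fresh "P" in apply/permP => P;
  rewrite /= ?count_cat /= ?count_cat /= ?count_cat /=;
  repeat match goal with |- context [nat_of_bool (P ?x)] => move: (nat_of_bool (P x)) => ? end;
  repeat match goal with |- context [count P ?x] => move: (count P x) => ? end;
  clear; lia.

Lemma well_formed_insert u v D D' :
    well_formed D -> label u \notin map label D -> label v \notin map label D ->
    label u != label v -> perm_eq D' [:: u, mate u, v, mate v & D] ->
  well_formed D'.
Proof.
move=> wf uD vD uv /well_formed_perm->; rewrite !well_formed_pair wf vD /= !inE.
by rewrite (negbTE uv) (negbTE uD).
Qed.

Section SwapMove.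
Variables (p q : visit) (a b : nat) (E : diagram_code).
Hypothesis wD : welded_diagram [:: p, q & E].
Hypotheses (pq : label p != label q) (ab : a != b).
Hypotheses (aD : a \notin map label [:: p, q & E]) (bD : b \notin map label [:: p, q & E]).
Hypothesis ok : swappable (lev p) (lev q).

Let wf : well_formed [:: p, q & E]. Proof. by case/welded_diagramP: wD. Qed.

Let Ep : {in E, forall v, label v = label p -> v = mate p}.
Proof. by move=> v vE; apply: (well_formed_unique wf); rewrite inE vE orbT. Qed.

Let Eq : {in E, forall v, label v = label q -> v = mate q}.
Proof.
have pe : perm_eq [:: p, q & E] [:: q, p & E] by rewrite (perm_catCA [:: p] [:: q] E).
move=> v vE; have wf' := wf; rewrite (well_formed_perm pe) in wf'.
by apply: (well_formed_unique wf'); rewrite inE vE orbT.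
Qed.

Let w1 := Visit a Weld (side p == side q).
Let w2 := Visit b Weld (side p != side q).

(** Whatever the order in which the other passages of the two crossings are met,
    a substitution that concerns them only leaves the rest of the code alone. *)
Lemma swap_split : exists A B C,
  [/\ E = A ++ mate q :: B ++ mate p :: C \/ E = A ++ mate p :: B ++ mate q :: C,
     forall f, (forall v, v != mate p -> v != mate q -> f v = [:: v]) ->
       [/\ expand f A = A, expand f B = B & expand f C = C]
   & perm_eq E [:: mate p, mate q & A ++ B ++ C]].
Proof.
have pE : mate p \in E.
  have := well_formed_mate wf (mem_head _ _); rewrite !inE (negbTE (mate_neq p)) /=.
  by case/orP=> // /eqP/(congr1 label) /= e; move: pq; rewrite e eqxx.
have qE : mate q \in E.
  have : mate q \in [:: p, q & E] by rewrite (well_formed_mate wf) // !inE eqxx orbT.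
  rewrite !inE (negbTE (mate_neq q)) /=.
  by case/orP=> // /eqP/(congr1 label) /= e; move: pq; rewrite e eqxx.
have uE : uniq E by move/well_formed_uniq: wf => /= /and3P[].
have mpq : mate p != mate q by apply: contraNneq pq => /(congr1 label) /= ->.
have [A [B [C [EE pe]]]] : exists A B C,
    (E = A ++ mate q :: B ++ mate p :: C \/ E = A ++ mate p :: B ++ mate q :: C)
    /\ perm_eq E [:: mate p, mate q & A ++ B ++ C].
  case/splitPr: pE qE => A C.
  rewrite mem_cat inE eq_sym (negbTE mpq) /= => /orP[]; case/splitPr=> A1 B.
    exists A1, B, C; split; first by left; rewrite -catA.
    by perm_count.
  exists A, A1, B; split; first by right.
  by perm_count.
exists A, B, C; split=> // f fE.
move: uE; rewrite (perm_uniq pe) /= !inE !negb_or => /and3P[/andP[_ pn] qn _].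
have fid s : {subset s <= A ++ B ++ C} -> expand f s = s.
  move=> sS; apply: expand_id => v /sS vS; apply: fE.
    by apply: contraNneq pn => <-.
  by apply: contraNneq qn => <-.
by split; apply: fid => v vs; rewrite !mem_cat vs ?orbT.
Qed.

Let bigon_subF v : v != mate p -> v != mate q -> bigon_expansion p q a b v = [:: v].
Proof. by move=> vp vq; rewrite /bigon_expansion (negbTE vp) (negbTE vq). Qed.

Let swap_subF v : v != mate p -> v != mate q -> swap_expansion p q a b v = [:: v].
Proof. by move=> vp vq; rewrite /swap_expansion (negbTE vp) (negbTE vq). Qed.

Let qpF : (mate q == mate p) = false.
Proof. by apply/eqP => /(congr1 label) /= qp; move: pq; rewrite qp eqxx. Qed.

Let bigon_diagram : welded_diagram ([:: p; q] ++ expand (bigon_expansion p q a b) E).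
Proof.
apply/welded_diagramP; split; last first.
  by apply: bigon_colourable => //; case/welded_diagramP: wD.
apply: (@well_formed_insert w1 w2 _ _ wf aD bD ab).
have [A [B [C [EE /(_ _ bigon_subF)[sA sB sC] pe]]]] := swap_split.
case: EE => ->; rewrite !(expand_cat, expand_cons) sA sB sC /bigon_expansion qpF !eqxx;
by rewrite /w1 /w2 /mate /=; case: (side p); case: (side q); perm_count.
Qed.

Let swap_diagram : welded_diagram ([:: q; p] ++ expand (swap_expansion p q a b) E).
Proof.
apply/welded_diagramP; split; last first.
  by apply: swap_colourable => //; case/welded_diagramP: wD.
apply: (@well_formed_insert w1 w2 _ _ wf aD bD ab).
have [A [B [C [EE /(_ _ swap_subF)[sA sB sC] pe]]]] := swap_split.
case: EE => ->; rewrite !(expand_cat, expand_cons) sA sB sC /swap_expansion qpF !eqxx;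
by rewrite /w1 /w2 /mate /=; case: (side p); case: (side q); perm_count.
Qed.

Let equiv_bigon_eq D D' u v o X Y Z :
    D = X ++ Y ++ Z -> D' = X ++ [:: u; v] ++ Y ++ strand o (mate u) (mate v) ++ Z ->
    lev u = lev v -> side u = ~~ side v ->
    welded_diagram D -> welded_diagram D' -> welded_equivalent D D'.
Proof. by move=> -> ->; apply: equiv_bigon. Qed.

Let equiv_triangle_eq D D' x y c h op oq or A B C :
    D = strand op x y ++ A ++ strand oq (mate y) c ++ B
          ++ strand or (mate c) (mate x) ++ C ->
    D' = strand (~~ op) x y ++ A ++ strand (~~ oq) (mate y) c ++ B
          ++ strand (~~ or) (mate c) (mate x) ++ C ->
    [|| passable (lev x) (lev y), passable (lev (mate y)) (lev c)
      | passable (lev (mate c)) (lev (mate x))] ->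
    side y = h (+) (op == oq) -> side c = h (+) (oq == or) ->
    side (mate x) = h (+) (or == op) ->
    welded_diagram D -> welded_diagram D' -> welded_equivalent D D'.
Proof. by move=> -> ->; apply: equiv_triangle. Qed.

Let W1 := Visit a Weld.
Let W2 := Visit b Weld.

(* The cases are the two orders of the mates and the four pairs of sides; they
   differ in the order and in the direction of the new passages. *)
Let equiv_add_bigon :
  welded_equivalent [:: p, q & E] ([:: p; q] ++ expand (bigon_expansion p q a b) E).
Proof.
have [A [B [C [EE /(_ _ bigon_subF)[sA sB sC] pe]]]] := swap_split.
move: wD bigon_diagram; case: EE => ->;
rewrite !(expand_cat, expand_cons) sA sB sC /bigon_expansion qpF !eqxx;
case sp: (side p); case sq: (side q); rewrite -?catA [_ == _]/= [~~ _]/=.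
- by apply: (@equiv_bigon_eq _ _ (W1 false) (W2 true) true (p :: q :: A ++ [:: mate q]) (B ++ [:: mate p]) C) => //;
  rewrite /= -?catA.
- by apply: (@equiv_bigon_eq _ _ (W2 false) (W1 true) false (p :: q :: A) (mate q :: B ++ [:: mate p]) C) => //;
  rewrite /= -?catA.
- by apply: (@equiv_bigon_eq _ _ (W1 true) (W2 false) false (p :: q :: A ++ [:: mate q]) B (mate p :: C)) => //;
  rewrite /= -?catA.
- by apply: (@equiv_bigon_eq _ _ (W2 true) (W1 false) true (p :: q :: A) (mate q :: B) (mate p :: C)) => //;
  rewrite /= -?catA.
- by apply: (@equiv_bigon_eq _ _ (W1 true) (W2 false) true (p :: q :: A ++ [:: mate p]) (B ++ [:: mate q]) C) => //;
  rewrite /= -?catA.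
- by apply: (@equiv_bigon_eq _ _ (W1 false) (W2 true) false (p :: q :: A ++ [:: mate p]) B (mate q :: C)) => //;
  rewrite /= -?catA.
- by apply: (@equiv_bigon_eq _ _ (W2 true) (W1 false) false (p :: q :: A) (mate p :: B ++ [:: mate q]) C) => //;
  rewrite /= -?catA.
- by apply: (@equiv_bigon_eq _ _ (W2 false) (W1 true) true (p :: q :: A) (mate p :: B) (mate q :: C)) => //;
  rewrite /= -?catA.
Qed.

Let equiv_flip :
  welded_equivalent ([:: p; q] ++ expand (bigon_expansion p q a b) E)
    ([:: q; p] ++ expand (swap_expansion p q a b) E).
Proof.
have [A [B [C [EE sE pe]]]] := swap_split.
have [[sA sB sC] [tA tB tC]] := (sE _ bigon_subF, sE _ swap_subF).
have ok1 : [|| passable (lev p) (lev q), passable (opposite (lev q)) Weld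
             | passable Weld (opposite (lev p))].
  by move: ok; rewrite /passable; case: (lev p) (lev q) => [] [].
have ok2 : [|| passable (lev q) (lev p), passable (opposite (lev p)) Weld
             | passable Weld (opposite (lev q))].
  by move: ok; rewrite /passable; case: (lev p) (lev q) => [] [].
move: bigon_diagram swap_diagram; case: EE => ->;
rewrite !(expand_cat, expand_cons) sA sB sC tA tB tC /bigon_expansion /swap_expansion qpF !eqxx;
case sp: (side p); case sq: (side q); rewrite -?catA [_ == _]/= [~~ _]/=.
- by apply: (@equiv_triangle_eq _ _ p q (W1 false) false true true false A (W2 true :: B) (W2 false :: C)) => //;
  rewrite /= ?sp ?sq -?catA //.
- by apply: (@equiv_triangle_eq _ _ p q (W1 true) false true false false (A ++ [:: W2 false]) B (W2 true :: C)) => //;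
  rewrite /= ?sp ?sq -?catA //.
- by apply: (@equiv_triangle_eq _ _ p q (W1 true) false true true true A (W2 false :: B ++ [:: W2 true]) C) => //;
  rewrite /= ?sp ?sq -?catA //.
- by apply: (@equiv_triangle_eq _ _ p q (W1 false) false true false true (A ++ [:: W2 true]) (B ++ [:: W2 false]) C) => //;
  rewrite /= ?sp ?sq -?catA //.
- by apply: (@equiv_triangle_eq _ _ q p (W1 true) true false true false A (W2 false :: B) (W2 true :: C)) => //;
  rewrite /= ?sp ?sq -?catA //.
- by apply: (@equiv_triangle_eq _ _ q p (W1 false) true false true true A (W2 true :: B ++ [:: W2 false]) C) => //;
  rewrite /= ?sp ?sq -?catA //.
- by apply: (@equiv_triangle_eq _ _ q p (W1 false) true false false false (A ++ [:: W2 true]) B (W2 false :: C)) => //;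
  rewrite /= ?sp ?sq -?catA //.
- by apply: (@equiv_triangle_eq _ _ q p (W1 true) true false false true (A ++ [:: W2 false]) (B ++ [:: W2 true]) C) => //;
  rewrite /= ?sp ?sq -?catA //.
Qed.

(** A welded bigon is created between the strands crossing [p] and [q], next to
    the edge from [p] to [q], and then the strand of [p] and [q] is slid across
    its nearest corner.  The distinguished strand of the triangle is the strand
    of [p] and [q] if both are over passages, and otherwise the strand crossing
    at the welded passage. *)
Lemma equiv_swap :
  welded_equivalent [:: p, q & E] [:: q, p & expand (swap_expansion p q a b) E]
  /\ welded_diagram [:: q, p & expand (swap_expansion p q a b) E].
Proof. by split; [exact: welded_trans equiv_add_bigon equiv_flip | exact: swap_diagram]. Qed.

End SwapMove.

(** * The two sides of a simple loop *)

(** A point of the curve is inside the loop when the number of times that the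
    curve has crossed the loop to reach it is odd; [L] is the list of the
    crossings on the loop and [b] tells where the path [s] starts.  That this
    has a geometric meaning is the content of [loop_sides]. *)
Definition inside (L : seq nat) (b : bool) (s : diagram_code) : bool :=
  b (+) odd (count (fun v => label v \in L) s).

Arguments inside : simpl never.

Fixpoint inside_passages (L : seq nat) (b : bool) (s : diagram_code) : nat :=
  if s is v :: s' then
    if label v \in L then inside_passages L (~~ b) s'
    else b + inside_passages L b s'
  else 0.

Lemma inside_cat L b s t : inside L b (s ++ t) = inside L (inside L b s) t.
Proof. by rewrite /inside count_cat oddD addbA. Qed.

Lemma inside_cons L b v s :
  inside L b (v :: s) = inside L (if label v \in L then ~~ b else b) s.
Proof. by rewrite /inside /= oddD; case: (_ \in L); rewrite /= ?addNb ?addbN. Qed.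

Lemma inside_passages_cat L b s t :
  inside_passages L b (s ++ t) = inside_passages L b s + inside_passages L (inside L b s) t.
Proof.
elim: s b => [|v s IH] b /=; first by rewrite /inside /= addbF.
by rewrite inside_cons; case: ifP => _; rewrite IH ?addnA.
Qed.

Lemma eq_inside_passages L L' b s :
  {in s, forall v, (label v \in L) = (label v \in L')} ->
  inside_passages L b s = inside_passages L' b s.
Proof.
elim: s b => //= v s IH b LL'; rewrite LL' ?mem_head // !IH // => w ws;
by apply: LL'; rewrite inE ws orbT.
Qed.

Lemma exists_inside_passage L s : 0 < inside_passages L false s ->
  exists C1 v y C2, [/\ s = C1 ++ [:: v, y & C2], label v \in L, label y \notin L
    & inside L false C1 = false].
Proof.
have [n] := ubnP (size s); elim: n s => // n IH [|v s] //= /ltnSE sn.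
have [vL|vL] := boolP (label v \in L); last first.
  move=> /(IH _ sn)[C1 [u [y [C2 [-> uL yL iC]]]]].
  by exists (v :: C1), u, y, C2; split=> //; rewrite inside_cons (negbTE vL).
case: s sn => [|y s] //= sn; have [yL|yL] := boolP (label y \in L); last first.
  by move=> _; exists [::], v, y, s.
move=> /(IH _ (ltnW sn))[C1 [u [z [C2 [-> uL zL iC]]]]].
by exists [:: v, y & C1], u, z, C2; split=> //; rewrite !inside_cons vL yL.
Qed.

Lemma well_formed_eq D u v : well_formed D -> u \in D -> v \in D ->
  label u = label v -> u = v \/ u = mate v.
Proof.
move=> wf uD /perm_to_rem pv uv; move: wf uD; rewrite (well_formed_perm pv) (perm_mem pv).
by rewrite inE => wf /orP[/eqP|ur]; [left | right; apply: well_formed_unique wf _ ur uv].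
Qed.

(** The loop runs from the crossing [x] back to it; [C] is the rest of the
    curve.  The corner of [x] between the two ends of the loop lies inside. *)
Section Loop.
Variables (x : visit) (W C : diagram_code).
Notation D := (x :: W ++ mate x :: C).
Hypothesis wD : welded_diagram D.
Hypothesis uW : uniq (map label W).
Let L := map label W.

Let wf : well_formed D. Proof. by case/welded_diagramP: wD. Qed.
Let uD : uniq D. Proof. exact: well_formed_uniq. Qed.

Lemma loop_label : label x \notin L /\ label x \notin map label C.
Proof.
have pe : perm_eq D [:: x, mate x & W ++ C].
  by rewrite perm_cons (perm_catCA W [:: mate x] C).
move: wf; rewrite (well_formed_perm pe) well_formed_pair map_cat mem_cat negb_or.
by case/andP=> /andP[].
Qed.

Let xL := proj1 loop_label.
Let xC := proj2 loop_label.

Lemma mate_loop q : q \in W -> mate q \in C.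
Proof.
move=> qW; have : mate q \in D.
  by apply: well_formed_mate => //; rewrite inE mem_cat qW orbT.
have qx : label q != label x by apply: contraNneq xL => <-; rewrite map_f.
rewrite inE mem_cat inE => /or4P[/eqP mq|mqW|/eqP mq|//].
- by move: qx; rewrite -mq eqxx.
- have /perm_to_rem pq := qW; have := uW; rewrite (perm_uniq (perm_map label pq)) /=.
  have : mate q \in rem q W by move: mqW; rewrite (perm_mem pq) inE (negbTE (mate_neq q)).
  by move/(map_f label) => /= ->.
by move: qx; rewrite -[label q]/(label (mate q)) mq eqxx.
Qed.

Lemma mate_outside v : v \in C -> (label v \in L) = (mate v \in W).
Proof.
move=> vC; apply/mapP/idP => [[q qW vq]|mW]; last by exists (mate v).
have vD : v \in D by rewrite inE mem_cat inE vC !orbT.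
have qD : q \in D by rewrite inE mem_cat qW orbT.
case: (well_formed_eq wf vD qD vq) => [E|->]; last by rewrite mateK.
move: uD; rewrite /= cat_uniq => /andP[_ /and3P[_ /hasPn/(_ v) hC _]].
by move: hC; rewrite inE vC orbT E qW => /(_ isT).
Qed.

Lemma mate_rest v : v \in C -> label v \notin L -> mate v \in C.
Proof.
move=> vC vL; have vx : label v != label x by apply: contraNneq xC => <-; rewrite map_f.
have : mate v \in D by apply: well_formed_mate => //; rewrite inE mem_cat inE vC !orbT.
rewrite inE mem_cat inE -mate_outside // (negbTE vL) /=.
by case/or3P=> // /eqP/(congr1 label) /= E; move: vx; rewrite E eqxx.
Qed.

(** The indicator function of the inside, up to a constant: the flow that jumps
    at [x] only runs once around the loop, so the colouring changes exactly
    when the loop is crossed. *)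
Lemma loop_colouring : exists (k : colouring) (c l : bool),
  [/\ {in W, forall q, before k (plain q) = (l, ~~ l)},
     traverses k (c, c) (shadow C) (c, c)
   & {in C, forall v u, before k (plain v) = (u, u) ->
       after k (plain v) = if label v \in L then (~~ u, ~~ u) else (u, u)}].
Proof.
case/welded_diagramP: wD => _ col.
have [k [i [ke tr fl]]] := col (pred1 (label x)) false.
have {ke}j v : v \in D -> jump (k (label v)) = (label v == label x).
  by move=> vD; rewrite ke // map_fst_shadow map_f.
have jC v : v \in C -> jump (k (label v)) = false.
  move=> vC; rewrite j ?inE ?mem_cat ?inE ?vC ?orbT //.
  by apply: contraNF xC => /eqP<-; rewrite map_f.
have jW v : v \in W -> jump (k (label v)) = false.
  move=> vC; rewrite j ?inE ?mem_cat ?inE ?vC ?orbT //.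
  by apply: contraNF xL => /eqP<-; rewrite map_f.
have jx : jump (k (label x)) by rewrite j ?eqxx // mem_head.
have flow_in s a o : traverses k a (shadow s) o -> {in s, forall v, jump (k (label v)) = false} ->
    {in s, forall v, flow (before k (plain v)) = flow a} /\ flow o = flow a.
  elim: s a => [|v s IH] a /=; first by move/eqP->; split.
  case/andP=> /eqP<- /IH IHs js; case: IHs => [w ws|IH1 ->].
    by apply: js; rewrite inE ws orbT.
  rewrite flow_after js ?mem_head // addbF; split=> // w; rewrite inE => /orP[/eqP->//|/IH1->].
  by rewrite flow_after js ?mem_head // addbF.
move: tr; rewrite -cat1s -[mate x :: C]cat1s !shadow_cat.
case/traverses_cat=> m1 t1 /traverses_cat[m2 tW /traverses_cat[m3 t2 tC]].
have f1 : flow m1 = true.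
  by move: t1; rewrite /= => /andP[/eqP bx /eqP<-]; rewrite flow_after /= jx bx fl.
have [fW f2] := flow_in _ _ _ tW jW.
have f3 : flow m3 = false.
  by move: t2; rewrite /= => /andP[/eqP bx /eqP<-]; rewrite flow_after /= jx bx f2 f1.
have [fC _] := flow_in _ _ _ tC jC.
case: m1 f1 t1 tW f2 fW => l r f1 t1 tW f2 fW.
case: i fl t1 tC => c c'; rewrite {1}/flow /= => fl t1 tC.
have {f1} ? : r = ~~ l by move: f1; rewrite /flow /=; case: (l) (r) => [] [].
have {fl} ? : c' = c by move: fl; case: (c) (c') => [] [].
subst r c'.
have m3c : m3 = (c, c).
  case: m3 f3 t2 {tC fC} => d d'; rewrite /flow /= => f3 t2.
  have ? : d' = d by move: f3; case: (d) (d') => [] [].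
  subst d'; case/andP: t1 => /eqP b1 _; case/andP: t2 => _ /eqP a2.
  move: b1 a2; rewrite /before /after /=; case: (k _) => [[? ?] [? ?]].
  by case: (side x) => /=; congruence.
rewrite m3c in tC.
have strand_flows v : v \in C ->
    flow (before k (plain v)) = false /\ flow (after k (plain v)) = false.
  by move=> vC; rewrite flow_after jC ?fC ?f3.
have loop_flows q : q \in W ->
    flow (before k (plain q)) = true /\ flow (after k (plain q)) = true.
  by move=> qW; rewrite flow_after jW // fW // /flow /= addbN addbb.
exists k, c, l; split=> //.
  move=> {jW jC fW f2 fC t1}; elim: (W) l loop_flows mate_loop tW => //= q s IH l flows mC.
  case/andP=> /eqP bq ts v; rewrite inE => /orP[/eqP->//|vs].
  suff aq : after k (plain q) = (l, ~~ l).
    rewrite aq in ts; apply: (IH _ _ _ ts) => // w ws; [apply: flows|apply: mC];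
    by rewrite inE ws orbT.
  have [] := flows _ (mem_head _ _); have [] := strand_flows _ (mC _ (mem_head _ _)).
  move: bq; rewrite /flow /before /after /=; case: (k _) => [[nw ne] [sw se]].
  by case: (side q); case: nw; case: ne; case: sw; case: se; case: l {ts flows mC} => //=.
move=> v vC u; have [] := strand_flows _ vC; case: ifP => vL.
  have := mate_outside vC; rewrite vL => /esym/loop_flows[].
  rewrite /flow /before /after /=; case: (k _) => [[nw ne] [sw se]].
  by case: (side v); case: nw; case: ne; case: sw; case: se; case: u.
have /strand_flows[] : mate v \in C by rewrite mate_rest // vL.
rewrite /flow /before /after /=; case: (k _) => [[nw ne] [sw se]].
by case: (side v); case: nw; case: ne; case: sw; case: se; case: u.
Qed.

(** The curve ends outside; the two strands of a crossing off the loop are on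
    the same side of the loop; and the recorded bit of a passage through the loop
    tells whether the curve enters or leaves it. *)
Lemma loop_sides :
  [/\ inside L false C = false,
     (forall C1 C2 C1' C2' v, label v \notin L -> C = C1 ++ v :: C2 ->
        C = C1' ++ mate v :: C2' -> inside L false C1 = inside L false C1')
   & exists s, forall C1 C2 v, label v \in L -> C = C1 ++ v :: C2 ->
        side (mate v) = s (+) inside L false C1].
Proof.
have [k [c [l [kW tC kC]]]] := loop_colouring.
have trC (s : diagram_code) u o : {subset s <= C} -> traverses k (u, u) (shadow s) o ->
    o = (inside L u s, inside L u s).
  elim: s u => [|v s IH] u sC /=; first by move/eqP<-; rewrite /inside addbF.
  case/andP=> /eqP bv; rewrite (kC v _ _ bv); last by apply: sC; rewrite mem_head.
  rewrite inside_cons -(fun_if (fun b => (b, b))) => /IH-> //.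
  by move=> w ws; apply: sC; rewrite inE ws orbT.
have insideE u s : inside L u s = u (+) inside L false s by [].
have at_v C1 v C2 : C = C1 ++ v :: C2 ->
    before k (plain v) = (c (+) inside L false C1, c (+) inside L false C1).
  move=> CE; move: tC; rewrite CE shadow_cat => /traverses_cat[m t1 /andP[/eqP-> _]].
  rewrite -insideE; apply: trC t1 => w w1.
  by rewrite CE mem_cat w1.
split.
- have := trC _ _ _ (fun _ => id) tC; rewrite insideE => -[].
  by case: (c); case: inside.
- move=> C1 C2 C1' C2' v vL /at_v + /at_v.
  rewrite /before /=; case: (k _) => [[? ?] [? ?]].
  by case: (side v) => /= -[e1 e2] [e3 e4]; apply: (@addbI c); congruence.
exists (c (+) l) => C1 C2 v vL /[dup] CE /at_v.
have vC : v \in C by rewrite CE mem_cat mem_head orbT.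
have := kW (mate v); rewrite -mate_outside // vL => /(_ isT).
rewrite /before /=; case: (k _) => [[? ?] [? ?]].
case: (side v) => /= -[e1 e2] [e3 e4]; move: (inside L false C1) => i in e1 e2 e3 e4 *.
  by have : l = c (+) i by [congruence]; move=> ->; case: (c) (i) => [] [].
by have : ~~ l = c (+) i by [congruence]; case: (l) (c) (i) => [] [] [].
Qed.

End Loop.

(** * Clearing the disc bounded by a loop *)

Definition erase (L : seq nat) (s : diagram_code) : diagram_code :=
  [seq v <- s | label v \notin L].

Definition fresh (D : diagram_code) : nat := (\max_(v <- D) label v).+1.

Lemma fresh_gt D v : v \in D -> label v < fresh D.
Proof. by move=> vD; rewrite ltnS; apply: leq_bigmax_seq. Qed.

Lemma freshP D n : fresh D <= n -> n \notin map label D.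
Proof. by move=> Dn; apply/negP=> /mapP[v /fresh_gt vD nv]; move: vD; rewrite -nv ltnNge Dn. Qed.

(** The curve enters the disc by crossing the loop at [v] and then goes through
    the crossing [y].  Exchanging [v] and [y] moves [y] out of the disc. *)
Section PushOut.
Variables (x : visit) (W C1 C2 : diagram_code) (v y : visit).
Notation C := (C1 ++ [:: v, y & C2]).
Notation D := (x :: W ++ mate x :: C).
Hypothesis wD : welded_diagram D.
Hypothesis weldW : all (fun v => lev v == Weld) W.
Hypothesis uW : uniq (map label W).
Let L := map label W.
Hypotheses (vL : label v \in L) (yL : label y \notin L) (out1 : inside L false C1 = false).

Let a := fresh D.
Let b := a.+1.
Let f := swap_expansion v y a b.
Let W' := expand f W.
Let C' := expand f C1 ++ [:: y, v & expand f C2].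

Let vC : v \in C. Proof. by rewrite mem_cat mem_head orbT. Qed.
Let yC : y \in C. Proof. by rewrite mem_cat !inE eqxx !orbT. Qed.
Let mvW : mate v \in W. Proof. by rewrite -(mate_outside wD). Qed.
Let myW : mate y \notin W.
Proof. by rewrite -(mate_outside wD). Qed.
Let xC := proj2 (loop_label wD).
Let xL := proj1 (loop_label wD).
Let wf : well_formed D. Proof. by case/welded_diagramP: wD. Qed.

Let vy : label v != label y.
Proof. by apply: contraNneq yL => <-. Qed.

Let aD : a \notin map label D. Proof. exact: freshP. Qed.
Let bD : b \notin map label D. Proof. exact: freshP. Qed.

Let fid u : label u = label x -> f u = [:: u].
Proof.
move=> ux; rewrite /f /swap_expansion; case: eqP => [uv|_].
  by case/negP: xC; rewrite -ux uv /= map_f.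
case: eqP => [uy|//].
by case/negP: xC; rewrite -ux uy /= map_f.
Qed.

Let push_swap : welded_equivalent D (x :: W' ++ mate x :: C') /\
  welded_diagram (x :: W' ++ mate x :: C').
Proof.
have D1 : D = (x :: W ++ mate x :: C1) ++ [:: v, y & C2] by rewrite /= -catA.
have w1 := wD; rewrite D1 in w1.
have w2 := welded_diagram_rot w1.
have e1 := equiv_rot w1; rewrite -D1 in e1.
have ab : a != b by rewrite /b neq_ltn ltnSn.
have pe : perm_eq D ([:: v, y & C2] ++ x :: W ++ mate x :: C1) by rewrite D1 perm_catC.
have fresh' n : n \notin map label D ->
    n \notin map label [:: v, y & C2 ++ x :: W ++ mate x :: C1].
  by rewrite (perm_mem (perm_map label pe)).
have ok : swappable (lev v) (lev y).
  have /eqP := allP weldW _ mvW; rewrite /swappable /=; case: (lev v) => //= _.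
have [] := equiv_swap w2 vy ab (fresh' _ aD) (fresh' _ bD) ok.
rewrite -/f expand_cat expand_cons expand_cat expand_cons !fid //= => e2 w3.
have r : (x :: W' ++ mate x :: expand f C1) ++ [:: y, v & expand f C2] = x :: W' ++ mate x :: C'.
  by rewrite /= -catA.
have w4 : welded_diagram ([:: y, v & expand f C2] ++ (x :: W' ++ mate x :: expand f C1)) := w3.
have e3 := equiv_rot w4; have w5 := welded_diagram_rot w4.
rewrite r in e3 w5; split=> //.
exact: welded_trans e1 (welded_trans e2 e3).
Qed.

Let fresh_labels u : u \in D -> label u != a /\ label u != b.
Proof.
move=> uD; split; [apply: contraNneq aD | apply: contraNneq bD] => <-; exact: map_f.
Qed.

Let push_labels : [/\ all (fun u => lev u == Weld) W', uniq (map label W')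
  & map label W' =i [:: a, b & L]].
Proof.
have [A [B WE]] : exists A B, W = A ++ mate v :: B.
  by case/splitPr: mvW => A B; exists A, B.
have fAB s : {subset s <= W} -> mate v \notin s -> expand f s = s.
  move=> sW vs; apply: expand_id => u us; rewrite /f /swap_expansion.
  case: eqP => [uv|_]; first by rewrite -uv us in vs.
  by case: eqP => // uy; move: myW; rewrite -uy sW.
have vAB : mate v \notin A ++ B.
  have uW' : uniq W by apply: map_uniq uW.
  move: uW'; rewrite WE (perm_uniq (permEl (perm_catCA A [:: mate v] B))) /=.
  by case/andP.
have [vA vB] : mate v \notin A /\ mate v \notin B.
  by move: vAB; rewrite mem_cat negb_or => /andP.
have W'E : W' = A ++ f (mate v) ++ B.
  rewrite /W' WE expand_cat expand_cons !fAB // => u us; rewrite WE mem_cat ?inE us ?orbT //.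
have vMv : v == mate v = false by rewrite eq_sym (negbTE (mate_neq v)).
have pf : perm_eq W' [:: Visit a Weld (side v == side y), Visit b Weld (side v != side y) & W].
  rewrite W'E WE /f /swap_expansion eqxx; case: (side v); perm_count.
have pl := perm_map label pf; split.
- by rewrite (perm_all _ pf) /= weldW.
- rewrite (perm_uniq pl) /= uW inE negb_or !andbT.
  have lD n : n \notin map label D -> n \notin map label W.
    by apply: contra => /mapP[q qW ->]; apply: map_f; rewrite inE mem_cat qW orbT.
  by rewrite lD // lD // andbT /b neq_ltn ltnSn.
- by move=> n; rewrite (perm_mem pl).
Qed.

Let L' := map label W'.

Let CD u : u \in C -> u \in D.
Proof. by move=> uC; rewrite inE mem_cat inE uC !orbT. Qed.

Let memL' u : u \in C -> (label u \in L') = (label u \in L).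
Proof.
move=> /CD/fresh_labels[ua ub]; case: push_labels => _ _ ->.
by rewrite !inE (negbTE ua) (negbTE ub).
Qed.

Let mvC : mate v \notin C.
Proof.
have := well_formed_uniq wf; rewrite /= cat_uniq => /andP[_ /and3P[_ /hasPn h _]].
by apply/negP=> mC; have := h (mate v); rewrite inE mC orbT mvW => /(_ isT).
Qed.

Let sub_rest u : u \in C -> f u =
  if u == mate y then if side y then [:: Visit a Weld (~~ (side v == side y)); u;
  Visit b Weld (~~ (side v != side y))]
                      else [:: Visit b Weld (~~ (side v != side y)); u;
                      Visit a Weld (~~ (side v == side y))]
  else [:: u].
Proof.
move=> uC; rewrite /f /swap_expansion; case: eqP => // uv.
by move: mvC; rewrite -uv uC.
Qed.

Let aL' : a \in L'. Proof. by case: push_labels => _ _ ->; rewrite inE eqxx. Qed.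
Let bL' : b \in L'. Proof. by case: push_labels => _ _ ->; rewrite !inE eqxx orbT. Qed.
Let myL' : label y \notin L'. Proof. by rewrite memL'. Qed.

Let erase_sub s : {subset s <= C} -> erase L' (expand f s) = erase L s.
Proof.
elim: s => //= u s IH sC; rewrite expand_cons /erase filter_cat -!/(erase _ _).
have uC : u \in C by apply: sC; rewrite mem_head.
rewrite IH; last by move=> w ws; apply: sC; rewrite inE ws orbT.
rewrite sub_rest // -memL' //; case: eqP => [->|_] /=; last by case: ifP.
by case: (side y); rewrite /= ?aL' ?bL' /= (negbTE myL').
Qed.

Let inside_sub (s : diagram_code) i : {subset s <= C} ->
    (forall s1 s2, s = s1 ++ mate y :: s2 -> inside L i s1 = true) ->
  inside L' i (expand f s) = inside L i s /\
  inside_passages L' i (expand f s) <= inside_passages L i s.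
Proof.
elim: s i => //= u s IH i sC iy; rewrite expand_cons.
have uC : u \in C by apply: sC; rewrite mem_head.
have sC' : {subset s <= C} by move=> w ws; apply: sC; rewrite inE ws orbT.
have iy' s1 s2 : s = s1 ++ mate y :: s2 ->
    inside L (if label u \in L then ~~ i else i) s1 = true.
  by move=> sE; rewrite -inside_cons (iy (u :: s1) s2) // sE.
rewrite sub_rest // inside_cons; case: eqP => [uy|_].
  have i1 : i = true by have := iy [::] s; rewrite uy /inside addbF => ->.
  have yL2 : (label y \in L) = false := negbTE yL.
  move: iy'; rewrite uy /= yL2 i1 => /(IH _ sC')[e1 e2].
  case: (side y); rewrite /= !inside_cons /= aL' bL' /= (negbTE myL') /= e1;
  by split=> //; apply: leq_trans e2 _; rewrite leq_addl.
rewrite /= inside_cons memL' //; case: ifP iy' => uL /(IH _ sC')[e1 e2] //.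
by rewrite e1 leq_add2l.
Qed.

(** Both passages of [y] leave the disc: the first because [v] now comes later,
    the second because it gets surrounded by the two new crossings with the
    loop.  All new crossings are on the loop, so the rest of the curve, as seen
    after erasing the loop, does not change. *)
Lemma push_out : exists W1 C0,
  [/\ welded_diagram (x :: W1 ++ mate x :: C0),
      welded_equivalent D (x :: W1 ++ mate x :: C0),
      all (fun u => lev u == Weld) W1 /\ uniq (map label W1),
      erase (map label W1) C0 = erase L C
    & inside_passages (map label W1) false C0 < inside_passages L false C].
Proof.
exists W', C'; have [eq wd'] := push_swap; have [lW' uW' _] := push_labels.
have [_ iy _] := loop_sides wD uW.
have C1C : {subset C1 <= C} by move=> u u1; rewrite mem_cat u1.
have C2C : {subset C2 <= C} by move=> u u2; rewrite mem_cat !inE u2 !orbT.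
have vL' : label v \in L' by rewrite memL'.
have iC1v : inside L false (C1 ++ [:: v]) = true.
  by rewrite inside_cat out1 inside_cons vL /inside addbF.
have iy1 := iy (C1 ++ [:: v]) C2 _ _ y yL.
split=> //.
  rewrite /C' /erase !filter_cat /= -!/(erase _ _) -/L' !erase_sub // vL vL' /=.
  by rewrite myL' yL.
have [|e1 l1] := @inside_sub C1 false C1C.
  move=> s1 s2 CE; rewrite -(iy1 s1 (s2 ++ [:: v, y & C2])) ?iC1v //.
    by rewrite -catA.
  by rewrite CE -catA.
have [|e2 l2] := @inside_sub C2 true C2C.
  move=> s1 s2 CE.
  have -> : inside L true s1 = inside L false (C1 ++ [:: v, y & s1]).
    by rewrite inside_cat out1 !inside_cons vL (negbTE yL).
  rewrite -(iy1 (C1 ++ [:: v, y & s1]) s2) ?iC1v //.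
    by rewrite -catA.
  by rewrite CE -catA.
rewrite -/L' /C' !inside_passages_cat e1 out1 /= (negbTE myL') (negbTE yL) vL vL' /= add0n add1n.
by rewrite addnS ltnS leq_add.
Qed.
End PushOut.

(** * Arcs across an empty disc *)

(** The disc bounded by the loop contains no crossing: the curve meets it in
    arcs without crossings, called chords, which have a passage through the
    loop at either end. *)
Section Arcs.
Variables (x : visit) (W C : diagram_code).
Notation D := (x :: W ++ mate x :: C).
Hypothesis wD : welded_diagram D.
Hypothesis uW : uniq (map label W).
Let L := map label W.
Hypothesis in0 : inside_passages L false C = 0.

Definition chord (v w : visit) : Prop := exists C1 C2,
  [/\ C = C1 ++ [:: v, w & C2], label v \in L, label w \in L & inside L false C1 = false].

Let wf : well_formed D. Proof. by case/welded_diagramP: wD. Qed.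
Let uC : uniq C.
Proof. by have := well_formed_uniq wf; rewrite /= cat_uniq /= => /and5P[]. Qed.
Let xC := proj2 (loop_label wD).
Let xL := proj1 (loop_label wD).

Lemma chord_exists v : v \in C -> label v \in L ->
  (exists w, chord v w) \/ (exists w, chord w v).
Proof.
move=> vC vL; have [inC _ _] := loop_sides wD uW.
have [C1 [C2 CE]] : exists C1 C2, C = C1 ++ v :: C2.
  by case/splitPr: vC => C1 C2; exists C1, C2.
have pas := in0; rewrite CE inside_passages_cat /= vL in pas.
have {}inC : inside L false (C1 ++ v :: C2) = false by rewrite -CE; apply: inC.
rewrite inside_cat inside_cons vL in inC.
have [i1|i1] := boolP (inside L false C1).
  case/lastP: C1 => [|C0 u] in CE pas inC i1 *; first by [].
  move: i1 pas; rewrite -cats1 inside_cat inside_cons inside_passages_cat /=.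
  case: ifP => uL i1 pas; last first.
    move: i1; rewrite {1}/inside addbF => i1.
    by move/eqP: pas; rewrite i1 !addn_eq0 /= ?andbF.
  right; exists u, C0, C2; split=> //; first by rewrite CE -cats1 -catA.
  by move: i1; rewrite {1}/inside addbF; case: inside.
case: C2 => [|w C2] in CE pas inC *.
  by move: inC; rewrite (negbTE i1) /inside.
have [wL|wL] := boolP (label w \in L).
  by left; exists w, C1, C2; split=> //; apply: negbTE.
by move/eqP: pas; rewrite /= (negbTE wL) (negbTE i1) !addn_eq0 /= ?andbF.
Qed.

Lemma chord_mem v w : chord v w -> [/\ v \in C, w \in C, v != w, mate v \in W & mate w \in W].
Proof.
case=> A [B [CE vL wL _]]; have vC : v \in C by rewrite CE mem_cat mem_head orbT.
have wC : w \in C by rewrite CE mem_cat !inE eqxx !orbT.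
rewrite -!(mate_outside wD) //; split=> //.
by move: uC; rewrite CE cat_uniq cons_uniq inE negb_or => /and3P[_ _ /andP[/andP[-> _] _]].
Qed.

Let mate_C q : q \in W -> q \notin C.
Proof.
have := well_formed_uniq wf; rewrite /= cat_uniq => /andP[_ /and3P[_ /hasPn h _]] qW.
by apply/negP=> qC; have := h q; rewrite inE qC orbT qW => /(_ isT).
Qed.

Lemma chord_inj v w v' w' : chord v w -> chord v' w' -> (v == v') = (w == w').
Proof.
move=> c c'; have [vC wC vw _ _] := chord_mem c; have [vC' wC' vw' _ _] := chord_mem c'.
have idx u t : u != t -> chord u t -> index t C = (index u C).+1.
  move=> ut [A [B [CE _ _ _]]].
  have ni z : z \in [:: u; t] -> z \notin A.
    move=> zut; apply/negP=> zA; move: uC; rewrite CE cat_uniq => /and3P[_ /hasPn/(_ z)].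
    by rewrite -[u :: _]/([:: u; t] ++ B) mem_cat zut zA => /(_ isT).
  rewrite CE !index_cat !(negbTE (ni _ _)) ?inE ?eqxx ?orbT //=.
  by rewrite eqxx (negbTE ut) eqxx addn0 addn1.
apply/eqP/eqP => E.
  by rewrite -(nth_index v wC) -(nth_index v wC') (idx _ _ vw c) (idx _ _ vw' c') E.
have := idx _ _ vw c; rewrite E (idx _ _ vw' c') => -[ivv'].
by rewrite -(nth_index v vC) -(nth_index v vC') ivv'.
Qed.

(** The flow that jumps at the ends of a chord runs along the chord and along
    the part of the loop between its ends. *)
Lemma chord_colouring v w : chord v w -> exists (k : colouring) (m m' : bool * bool),
  [/\ traverses k m (shadow W) m',
     forall v' w', chord v' w' -> before k (plain w') = after k (plain v')
   & forall v' w', chord v' w' -> flow (after k (plain v')) = (v == v')].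
Proof.
move=> cvw; have [vC wC vw vW wW] := chord_mem cvw.
have [A [B [CE vL wL _]]] := cvw.
pose eps l := (l == label v) || (l == label w).
case/welded_diagramP: wD => _ /(_ eps false)[k [i [ke tr fl]]].
have kD s : {subset s <= D} ->
    count (fun u : pvisit => jump (k u.1)) (shadow s) = count (fun u => eps (label u)) s.
  move=> sD; rewrite count_map; apply: eq_in_count => u us /=.
  by rewrite ke // map_fst_shadow map_f // sD.
have cW : odd (count (fun u => eps (label u)) W) = false.
  rewrite -(count_map label (fun l => eps l)) /eps.
  have := count_predUI (pred1 (label v)) (pred1 (label w)) (map label W).
  rewrite !count_uniq_mem // vL wL.
  rewrite (eq_count (a1 := predI _ _) (a2 := pred0)); last first.
    move=> l /=; apply/negP=> /andP[/eqP-> /eqP vwl].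
    have [||E|E] := well_formed_eq wf _ _ vwl.
    - by rewrite inE mem_cat inE vC !orbT.
    - by rewrite inE mem_cat inE wC !orbT.
    - by rewrite E eqxx in vw.
    - by have := mate_C vW; rewrite E mateK wC.
  by rewrite count_pred0 addn0 => /(congr1 odd).
have ex : eps (label x) = false.
  by apply/negP=> /orP[]/eqP xl; [rewrite -xl in vL | rewrite -xl in wL]; case/negP: xL.
have epsC u : u \in C -> eps (label u) = (u \in [:: v; w]).
  move=> uC'; rewrite /eps !inE; apply/idP/idP => [|/orP[]/eqP->]; rewrite ?eqxx ?orbT //.
  have uD : u \in D by rewrite inE mem_cat inE uC' !orbT.
  have vD : v \in D by rewrite inE mem_cat inE vC !orbT.
  have wD' : w \in D by rewrite inE mem_cat inE wC !orbT.
  case/orP=> /eqP ul.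
    case: (well_formed_eq wf uD vD ul) => [->|E]; first by rewrite eqxx.
    by have := mate_C vW; rewrite -E uC'.
  case: (well_formed_eq wf uD wD' ul) => [->|E]; first by rewrite eqxx orbT.
  by have := mate_C wW; rewrite -E uC'.
have split_tr C1 C2 : C = C1 ++ C2 ->
    exists2 m, traverses k i (shadow (x :: W ++ mate x :: C1)) m & traverses k m (shadow C2) i.
  move=> E; move: tr;
  rewrite E -[mate x :: _]cat1s -cat1s !catA shadow_cat => /traverses_cat[m t1 t2].
  by exists m => //; move: t1; rewrite -!catA.
have [m1 t1 t2] : exists2 m, traverses k i (shadow [:: x]) m & traverses k m (shadow (W ++ mate x :: C)) i.
  by apply/traverses_cat; rewrite -shadow_cat.
move: t2; rewrite shadow_cat => /traverses_cat[m2 tW _].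
exists k, m1, m2; split=> // v' w' [C1 [C2 [CE' vL' wL' _]]].
  by have [m _ /and3P[_ /eqP]] := split_tr _ _ CE'.
have CE2 : C = (C1 ++ [:: v']) ++ w' :: C2 by rewrite -catA.
have [m t1' /andP[/eqP bw _]] := split_tr _ _ CE2.
have [m' _ /and3P[_ /eqP <- _]] := split_tr _ _ CE'.
rewrite bw (traverses_flow t1') fl kD; last first.
  move=> u; rewrite [in X in _ -> X]CE2 !in_cons !(mem_cat _ W) !in_cons [in X in _ -> X](mem_cat _ (C1 ++ _)).
  by case/or4P=> ->; rewrite ?orbT.
rewrite /= count_cat /= !oddD cW ex /=.
have -> : C1 ++ [:: v'] = take (size C1).+1 C.
  by rewrite CE2 take_size_cat // size_cat addn1.
have vw_uniq : uniq [:: v; w] by rewrite /= inE vw.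
rewrite (eq_in_count (a2 := predU (pred1 v) (pred1 w))); last first.
  by move=> u /mem_take uC'; rewrite epsC // !inE.
have := count_predUI (pred1 v) (pred1 w) (take (size C1).+1 C).
rewrite (eq_count (a1 := predI _ _) (a2 := pred0)); last first.
  by move=> u /=; apply/negP=> /andP[/eqP-> /eqP E]; rewrite E eqxx in vw.
rewrite count_pred0 addn0 !count_uniq_mem ?take_uniq ?uC // => ->.
rewrite !in_take //.
have iv : index v C = size A.
  rewrite CE index_cat /= eqxx addn0; case: ifP => // vA.
  by move: uC; rewrite CE cat_uniq => /and3P[_ /hasPn/(_ v)]; rewrite mem_head vA => /(_ isT).
have iw : index w C = (size A).+1.
  rewrite CE index_cat /= eqxx (negbTE vw) addn1; case: ifP => // wA.
  by move: uC; rewrite CE cat_uniq => /and3P[_ /hasPn/(_ w)];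
  rewrite !inE eqxx orbT wA => /(_ isT).
have iv' : index v' C = size C1.
  rewrite CE' index_cat /= eqxx addn0; case: ifP => // vA.
  by move: uC; rewrite CE' cat_uniq => /and3P[_ /hasPn/(_ v')]; rewrite mem_head vA => /(_ isT).
have -> : (v == v') = (size A == size C1).
  apply/eqP/eqP => [E|E]; first by rewrite -iv -iv' E.
  have vC' : v' \in C by rewrite CE' mem_cat mem_head orbT.
  by rewrite -(nth_index v vC) -(nth_index v vC') iv iv' E.
rewrite iv iw !ltnS leq_eqVlt; case: eqVneq => [->|_]; first by rewrite ltnn.
by case: (_ < _).
Qed.

Lemma chord_sides : exists s, forall v w, chord v w -> side v = ~~ s /\ side w = s.
Proof.
have [_ _ [s sE]] := loop_sides wD uW; exists s => v w [A [B [CE vL wL inA]]].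
have sv := sE _ _ _ vL CE; rewrite inA addbF /= in sv.
have CE' : C = (A ++ [:: v]) ++ w :: B by rewrite -catA.
have sw := sE _ _ _ wL CE'; rewrite inside_cat inA inside_cons vL /inside /= in sw.
by split; [rewrite -sv negbK | apply: negb_inj; rewrite sw addbT].
Qed.

(** The values of a colouring on the inner side of an edge of the loop, which is
    the left one when [s] holds. *)
Definition inner (s : bool) (e : bool * bool) : bool := if s then e.1 else e.2.
Definition outer (s : bool) (e : bool * bool) : bool := if s then e.2 else e.1.

Lemma chord_corners s k v w : side v = ~~ s -> side w = s ->
    before k (plain w) = after k (plain v) -> let e := after k (plain v) in
  [/\ inner s (before k (plain (mate v))) = inner s e,
     inner s (after k (plain (mate v))) = outer s e,
     inner s (before k (plain (mate w))) = outer s e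
   & inner s (after k (plain (mate w))) = inner s e].
Proof.
move=> sv sw; rewrite /before /after /= sv sw /inner /outer.
case: (k (label v)) => [[? ?] [? ?]]; case: (k (label w)) => [[? ?] [? ?]].
by case: s {sv sw} => /= -[? ?]; split.
Qed.

(** Chords do not cross: the colouring of [chord_colouring] takes different
    values along the inner sides of the two parts into which the first chord
    divides the loop, whereas the second chord joins edges with the same
    values. *)
Lemma chord_nested v w v' w' Wa q1 Wb q2 Wc :
    chord v w -> chord v' w' -> v != v' ->
    W = Wa ++ q1 :: Wb ++ q2 :: Wc ->
    (q1, q2) = (mate v, mate w) \/ (q1, q2) = (mate w, mate v) ->
  (mate v' \in Wb) = (mate w' \in Wb).
Proof.
move=> c c' vv' WE q12; have [k [m [m' [tr kc kf]]]] := chord_colouring c.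
have [s cs] := chord_sides.
have step u t : chord u t ->
    [/\ inner s (after k (plain (mate u))) = (u == v) (+) inner s (before k (plain (mate u))),
       inner s (after k (plain (mate t))) = (u == v) (+) inner s (before k (plain (mate t)))
     & u != v -> inner s (before k (plain (mate u))) = inner s (before k (plain (mate t)))].
  move=> cut; have [su st] := cs _ _ cut.
  have [-> -> -> ->] := chord_corners su st (kc _ _ cut).
  have := kf _ _ cut; rewrite [v == u]eq_sym /flow /inner /outer.
  by case: (after _ _) => [[] []]; case: s {cs su st} => /= <-.
have [vC wC vw vW wW] := chord_mem c.
have uWW : uniq W by apply: map_uniq uW.
have const q : q \in W -> q != mate v -> q != mate w ->
    inner s (after k (plain q)) = inner s (before k (plain q)).
  move=> qW qv qw; have mC := mate_loop wD uW qW.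
  have mL : label (mate q) \in L := map_f label qW.
  have [[t ct]|[t ct]] := chord_exists mC mL.
    have [] := step _ _ ct; rewrite mateK => -> _ _.
    by rewrite (_ : mate q == v = false) //; apply: contraNF qv => /eqP<-; rewrite mateK.
  have [] := step _ _ ct; rewrite mateK => _ -> _.
  rewrite [t == v](chord_inj ct c) (_ : mate q == w = false) //.
  by apply: contraNF qw => /eqP<-; rewrite mateK.
have walk (t : diagram_code) n o : {subset t <= W} -> mate v \notin t -> mate w \notin t ->
    traverses k n (shadow t) o ->
  {in t, forall q, inner s (before k (plain q)) = inner s n} /\ inner s o = inner s n.
  elim: t n => [|q t IH] n tW; first by move=> _ _ /eqP->; split.
  rewrite !inE !negb_or => /andP[qv vt] /andP[qw wt] /= /andP[/eqP<- tr'].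
  have tW' : {subset t <= W} by move=> u ut; apply: tW; rewrite inE ut orbT.
  have [h1 ->] := IH _ tW' vt wt tr'.
  rewrite const ?tW ?mem_head 1?eq_sym // ; split=> // u.
  by rewrite inE => /orP[/eqP->//|/h1->]; rewrite const ?tW ?mem_head 1?eq_sym.
have flip q : q = mate v \/ q = mate w ->
    inner s (after k (plain q)) = ~~ inner s (before k (plain q)).
  by have [+ + _] := step _ _ c; rewrite eqxx => e1 e2 [] ->.
have q1f : q1 = mate v \/ q1 = mate w by case: q12 => -[-> _]; [left | right].
have q2f : q2 = mate v \/ q2 = mate w by case: q12 => -[_ ->]; [right | left].
have niW (t : diagram_code) : {subset t <= W} -> q1 \notin t -> q2 \notin t ->
    [/\ {subset t <= W}, mate v \notin t & mate w \notin t].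
  by move=> ? ? ?; case: q12 => -[<- <-]; split.
have [subA subB subC] : [/\ {subset Wa <= W}, {subset Wb <= W} & {subset Wc <= W}].
  by split=> u us; rewrite WE mem_cat ?inE ?mem_cat ?inE us ?orbT.
have [nA nB nC] : [/\ q1 \notin Wa /\ q2 \notin Wa, q1 \notin Wb /\ q2 \notin Wb
    & q1 \notin Wc /\ q2 \notin Wc].
  have pe : perm_eq W [:: q1, q2 & Wa ++ Wb ++ Wc] by rewrite WE; perm_count.
  have := uWW; rewrite (perm_uniq pe) /= inE !mem_cat !negb_or.
  by case/and3P=> /and4P[_ -> -> ->] /and3P[-> -> ->] _.
move: tr; rewrite WE shadow_cat => /traverses_cat[m1 tA].
rewrite -cat1s shadow_cat => /traverses_cat[m2 t1]; rewrite shadow_cat => /traverses_cat[m3 tB].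
rewrite -cat1s shadow_cat => /traverses_cat[m4 t2 tC].
have [sA vA wA] := niW _ subA nA.1 nA.2.
have [sB vB wB] := niW _ subB nB.1 nB.2.
have [sC vC2 wC2] := niW _ subC nC.1 nC.2.
have [hA oA] := walk _ _ _ sA vA wA tA.
have [hB oB] := walk _ _ _ sB vB wB tB.
have [hC oC] := walk _ _ _ sC vC2 wC2 tC.
have g2 : inner s m2 = ~~ inner s m.
  by move: t1 => /= /andP[/eqP b1 /eqP<-]; rewrite flip // b1 oA.
have g4 : inner s m4 = inner s m.
  by move: t2 => /= /andP[/eqP b1 /eqP<-]; rewrite flip // b1 oB g2 negbK.
have inB q : q \in W -> q != q1 -> q != q2 ->
    (q \in Wb) = (inner s (before k (plain q)) != inner s m).
  rewrite WE mem_cat inE mem_cat inE => + /negbTE qn1 /negbTE qn2.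
  rewrite qn1 qn2 /= => /or3P[qA|qB|qC].
  - rewrite (hA _ qA) eqxx; apply/negP=> qB; move: uWW; rewrite WE cat_uniq.
    by case/and3P=> _ /hasPn/(_ q); rewrite inE mem_cat qB orbT qA => /(_ isT).
  - by rewrite qB (hB _ qB) g2; case: inner.
  - rewrite (hC _ qC) g4 eqxx; apply/negP=> qB; move: uWW.
    have pe : perm_eq W [:: q1, q2 & Wa ++ Wb ++ Wc] by rewrite WE; perm_count.
    rewrite (perm_uniq pe) /= !cat_uniq => /and3P[_ _ /and3P[_ _ /and3P[_ /hasPn/(_ q)]]].
    by rewrite qC qB => /(_ isT).
have [vC' wC' _ vW' wW'] := chord_mem c'.
have [sv sw] := cs _ _ c; have [sv' sw'] := cs _ _ c'.
have n1 : mate v' != mate v by rewrite (inj_eq (inv_inj mateK)) eq_sym.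
have n2 : mate w' != mate w.
  by rewrite (inj_eq (inv_inj mateK)) eq_sym -(chord_inj c c').
have n3 : mate v' != mate w.
  rewrite (inj_eq (inv_inj mateK)); apply/eqP=> E; move: sv'; rewrite E sw.
  by case: (s).
have n4 : mate w' != mate v.
  rewrite (inj_eq (inv_inj mateK)); apply/eqP=> E; move: sw'; rewrite E sv.
  by case: (s).
have nn q : q != mate v -> q != mate w -> q != q1 /\ q != q2.
  by move=> ? ?; case: q12 => -[-> ->].
have [a1 a2] := nn _ n1 n3; have [b1 b2] := nn _ n4 n2.
rewrite !inB //; congr (~~ (_ == _)).
by have [_ _ ->] := step _ _ c'; rewrite // eq_sym.
Qed.

End Arcs.

Section Adjacent.
Variables (x : visit) (W C : diagram_code).
Notation D := (x :: W ++ mate x :: C).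
Hypothesis wD : welded_diagram D.
Hypothesis uW : uniq (map label W).
Hypothesis in0 : inside_passages (map label W) false C = 0.

Let linked q q' := chord W C (mate q) (mate q') \/ chord W C (mate q') (mate q).

(** An innermost chord cuts off a bigon. *)
Lemma adjacent_chord : W != [::] ->
  exists Wa q1 q2 Wc, W = Wa ++ [:: q1, q2 & Wc] /\ linked q1 q2.
Proof.
have uWW : uniq W by apply: map_uniq uW.
have partner q : q \in W -> exists2 q', q' \in W & linked q q'.
  move=> qW; have mL : label (mate q) \in map label W := map_f label qW.
  case: (chord_exists wD uW in0 (mate_loop wD uW qW) mL) => -[t ct];
  have [_ _ _ vW wW] := chord_mem wD ct.
    by exists (mate t); rewrite // /linked mateK; left.
  by exists (mate t); rewrite // /linked mateK; right.
have linkedC q q' : linked q q' -> linked q' q by case; [right | left].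
have linked_neq q q' : linked q q' -> q != q'.
  by case=> /(chord_mem wD)[_ _]; rewrite (inj_eq (inv_inj mateK)) 1?eq_sym.
have nested q1 q2 q q' Wa Wb Wc : W = Wa ++ q1 :: Wb ++ q2 :: Wc ->
    linked q1 q2 -> linked q q' -> q \in Wb -> q' \in Wb.
  move=> WE l12 lq qb.
  have pe : perm_eq W [:: q1, q2 & Wa ++ Wb ++ Wc] by rewrite WE; perm_count.
  have := uWW; rewrite (perm_uniq pe) /= inE !mem_cat !negb_or.
  case/and3P=> /and4P[_ _ n1 _] /and3P[_ n2 _] _.
  have qq1 : q1 != q by apply: contraNneq n1 => ->.
  have qq2 : q2 != q by apply: contraNneq n2 => ->.
  have mm u t : (mate u == mate t) = (u == t) := inj_eq (inv_inj mateK) u t.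
  case: l12 => c12; case: lq => cq.
  - have := @chord_nested _ _ _ wD uW in0 _ _ _ _ Wa q1 Wb q2 Wc c12 cq.
    by rewrite mm !mateK qb => <- //; left.
  - have := @chord_nested _ _ _ wD uW in0 _ _ _ _ Wa q1 Wb q2 Wc c12 cq.
    by rewrite (chord_inj wD c12 cq) mm !mateK qb => -> //; left.
  - have := @chord_nested _ _ _ wD uW in0 _ _ _ _ Wa q1 Wb q2 Wc c12 cq.
    by rewrite mm !mateK qb => <- //; right.
  - have := @chord_nested _ _ _ wD uW in0 _ _ _ _ Wa q1 Wb q2 Wc c12 cq.
    by rewrite (chord_inj wD c12 cq) mm !mateK qb => -> //; right.
(* A chord that starts between the ends of the given one has shorter span. *)
have shrink n Wa q1 Wb q2 Wc : size Wb < n -> W = Wa ++ q1 :: Wb ++ q2 :: Wc ->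
    linked q1 q2 -> exists Wa q1 q2 Wc, W = Wa ++ [:: q1, q2 & Wc] /\ linked q1 q2.
  elim: n Wa q1 Wb q2 Wc => // n IH Wa q1 [|q Wb] q2 Wc /=.
    by move=> _ WE l12; exists Wa, q1, q2, Wc.
  move=> sn WE l12; have qW : q \in W by rewrite WE !(mem_cat, inE) eqxx !orbT.
  have [q' q'W lqq'] := partner q qW.
  have : q' \in q :: Wb by apply: (nested q1 q2 q q' Wa _ Wc) => //; rewrite mem_head.
  rewrite inE eq_sym (negbTE (linked_neq _ _ lqq')) /= => q'b.
  case/splitPr: q'b WE sn => Y Z WE sn.
  apply: (IH (rcons Wa q1) q Y q' (Z ++ q2 :: Wc)) => //.
    by move: sn; rewrite size_cat /= ltnS; apply: leq_ltn_trans; rewrite leq_addr.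
  by rewrite WE cat_rcons /= -catA.
move=> Wn; have [q [W0 WE]] : exists q W0, W = q :: W0.
  by case: (W) Wn => // q W0; exists q, W0.
have qW : q \in W by rewrite WE mem_head.
have [q' q'W lqq'] := partner q qW.
have : q' \in W0 by move: q'W; rewrite WE inE eq_sym (negbTE (linked_neq _ _ lqq')).
move=> q'0; case/splitPr: q'0 WE => Y Z WE.
exact: (shrink (size Y).+1 [::] q Y q' Z).
Qed.

End Adjacent.

Lemma kink_removal x C : welded_diagram (x :: mate x :: C) ->
  welded_equivalent (x :: mate x :: C) C /\ welded_diagram C.
Proof.
move=> wD; have [wf col] := (welded_diagramP _).1 wD.
have wC : welded_diagram C.
  apply/welded_diagramP; move: wf col; rewrite well_formed_pair => /andP[xC wf] col.
  split=> //; apply: (@colourable_kink (label x) (side x)) => //.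
  by rewrite map_fst_shadow.
split=> //; apply: welded_sym; apply: equiv_move => //.
exact: (move_r1 x C).
Qed.

Lemma bigon_removal u v o X Y Z :
    lev u = lev v -> side u = ~~ side v ->
    welded_diagram (X ++ [:: u; v] ++ Y ++ strand o (mate u) (mate v) ++ Z) ->
  welded_equivalent (X ++ [:: u; v] ++ Y ++ strand o (mate u) (mate v) ++ Z) (X ++ Y ++ Z)
  /\ welded_diagram (X ++ Y ++ Z).
Proof.
move=> lv sv w; have w' := welded_diagram_rot w.
have [wf col] := (welded_diagramP _).1 w'; rewrite -!catA in wf col.
have pe : perm_eq ([:: u; v] ++ Y ++ strand o (mate u) (mate v) ++ Z ++ X)
    [:: u, mate u, v, mate v & Y ++ Z ++ X].
  by rewrite /strand; case: (o); perm_count.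
move: wf; rewrite (well_formed_perm pe) !well_formed_pair /= !inE !negb_or.
case/andP=> /and3P[uv _ uY] /andP[vY {}wf].
have wYZX : welded_diagram ((Y ++ Z) ++ X).
  apply/welded_diagramP; split; first by rewrite -catA.
  rewrite -catA; apply: (@colourable_bigon u v o) => //.
have w0 := welded_diagram_rot wYZX; split=> //.
by apply: welded_sym; apply: equiv_bigon.
Qed.

(** * Removal of welded loops *)

Notation welded_word := (all (fun v => lev v == Weld)).

Lemma erase_cat L s t : erase L (s ++ t) = erase L s ++ erase L t.
Proof. exact: filter_cat. Qed.

Lemma well_formed_two u v D : well_formed [:: u, mate u, v, mate v & D] ->
  label u \notin map label D /\ label v \notin map label D.
Proof.
rewrite !well_formed_pair /= !inE !negb_or.
by case/andP=> /and3P[_ _ ->] /andP[-> _].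
Qed.

(** The bigons cut off by innermost chords are removed one after the other,
    until the loop is a kink. *)
Lemma empty_loop_removal n x W C : size W <= n ->
    welded_diagram (x :: W ++ mate x :: C) -> welded_word W -> uniq (map label W) ->
    inside_passages (map label W) false C = 0 ->
  welded_equivalent (x :: W ++ mate x :: C) (erase (map label W) C)
  /\ welded_diagram (erase (map label W) C).
Proof.
elim: n W C => [|n IH] W C.
  rewrite leqn0 size_eq0 => /eqP-> /= wD _ _ _.
  by rewrite /erase filter_predT; apply: kink_removal.
move=> sW wD lW uW in0; have [W0|W0] := eqVneq W [::].
  by apply: IH => //; rewrite W0.
have [Wa [q1 [q2 [Wc [WE l12]]]]] := adjacent_chord wD uW in0 W0.
have [s cs] := chord_sides wD uW.
have [C1 [C2 [o [CE inC1]]]] : exists C1 C2 o,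
    C = C1 ++ strand o (mate q1) (mate q2) ++ C2 /\ inside (map label W) false C1 = false.
  by case: l12 => -[C1 [C2 [CE _ _ inC]]]; exists C1, C2; [exists true | exists false].
have s12 : side q1 = ~~ side q2.
  by case: l12 => /cs[/=]; case: (side q1); case: (side q2); case: (s).
have l12' : lev q1 = lev q2.
  by move: lW; rewrite WE all_cat /= => /and4P[_ /eqP-> /eqP-> _].
pose X := x :: Wa; pose Y := Wc ++ mate x :: C1.
have DE : x :: W ++ mate x :: C = X ++ [:: q1; q2] ++ Y ++ strand o (mate q1) (mate q2) ++ C2.
  by rewrite WE CE /X /Y /= -!catA.
have DE' : X ++ Y ++ C2 = x :: (Wa ++ Wc) ++ mate x :: (C1 ++ C2).
  by rewrite /X /Y /= -!catA.
have wDX := wD; rewrite DE in wDX.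
have [e1 w1] := bigon_removal l12' s12 wDX.
rewrite DE' in e1 w1; rewrite DE.
have pe : perm_eq (x :: W ++ mate x :: C)
    [:: q1, mate q1, q2, mate q2 & X ++ Y ++ C2].
  by rewrite DE /strand; case: (o); perm_count.
have [wf _] := (welded_diagramP _).1 wD.
move: wf; rewrite (well_formed_perm pe) => /well_formed_two[n1 n2].
set L0 := map label (Wa ++ Wc).
have LL0 u : u \in C1 ++ C2 -> (label u \in map label W) = (label u \in L0).
  move=> u12.
  have uD : label u \in map label (X ++ Y ++ C2).
    apply: map_f; rewrite /X /Y !(mem_cat, inE); move: u12; rewrite mem_cat => /orP[]->;
    by rewrite ?orbT.
  have u1 : (label u == label q1) = false by apply: contraNF n1 => /eqP<-.
  have u2 : (label u == label q2) = false by apply: contraNF n2 => /eqP<-.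
  by rewrite /L0 WE !map_cat /= !mem_cat !inE u1 u2.
have [||||e2 w2] := IH (Wa ++ Wc) (C1 ++ C2) _ w1.
- by move: sW; rewrite WE !size_cat /= !addnS -[_ <= n]ltnS; apply: leq_trans.
- by move: lW; rewrite WE !all_cat /= => /and4P[-> _ _ ->].
- move: uW; rewrite WE !map_cat /= !cat_uniq /= => /and3P[-> h /and3P[_ _ ->]].
  by move: h; rewrite !negb_or => /and3P[_ _ ->].
- rewrite -(eq_inside_passages _ LL0).
  have [v1 v2] : label q1 \in map label W /\ label q2 \in map label W.
    by rewrite WE !map_cat /= !mem_cat !inE !eqxx !orbT.
  move: in0; rewrite CE !inside_passages_cat inC1; case: (o);
  by rewrite /= v1 v2 /inside /= ?v1 ?v2.
have -> : erase (map label W) C = erase L0 (C1 ++ C2).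
  rewrite CE !erase_cat {2}/erase;
  have [v1 v2] : label q1 \in map label W /\ label q2 \in map label W.
    by rewrite WE !map_cat /= !mem_cat !inE !eqxx !orbT.
  have -> : [seq v <- strand o (mate q1) (mate q2) | label v \notin map label W] = [::].
    by case: (o); rewrite /= v1 v2.
  by rewrite -!erase_cat; apply: eq_in_filter => u /LL0->.
by split=> //; apply: welded_trans e1 e2.
Qed.

(** Induction on the number of passages inside the loop. *)
Lemma simple_loop_removal x W C :
    welded_diagram (x :: W ++ mate x :: C) -> welded_word W -> uniq (map label W) ->
  welded_equivalent (x :: W ++ mate x :: C) (erase (map label W) C)
  /\ welded_diagram (erase (map label W) C).
Proof.
have [n] := ubnP (inside_passages (map label W) false C).
elim: n W C => // n IH W C /ltnSE sn wD lW uW.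
have [i0|] := posnP (inside_passages (map label W) false C).
  exact: (empty_loop_removal (leqnn _)).
case/exists_inside_passage=> C1 [v [y [C2 [CE vL yL inC1]]]].
rewrite CE in wD sn *; have [W1 [C0 [w1 e1 [lW1 uW1] <- lt]]] := push_out wD lW uW vL yL inC1.
have [e2 w2] := IH W1 C0 (leq_trans lt sn) w1 lW1 uW1.
by split=> //; apply: welded_trans e1 e2.
Qed.

Lemma erase_keep L x s : label x \notin L -> erase L (x :: s) = x :: erase L s.
Proof. by rewrite /erase /= => ->. Qed.

Lemma erase_erase L1 L2 s : erase L1 (erase L2 s) = erase (L1 ++ L2) s.
Proof. by rewrite /erase -filter_predI; apply: eq_filter => v /=; rewrite mem_cat negb_or. Qed.

Lemma not_uniq_split (T : eqType) (g : visit -> T) W : ~~ uniq (map g W) ->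
  exists W1 u W2 v W3, W = W1 ++ u :: W2 ++ v :: W3 /\ g v = g u.
Proof.
elim: W => //= u W IH; rewrite negb_and negbK => /orP[/mapP[v vW uv]|/IH].
  by case/splitPr: vW => W2 W3; exists [::], u, W2, v, W3.
by case=> W1 [u' [W2 [v [W3 [-> vu]]]]]; exists (u :: W1), u', W2, v, W3.
Qed.

Lemma well_formed_loop A x W B : well_formed (A ++ x :: W ++ mate x :: B) ->
  label x \notin map label (A ++ W ++ B).
Proof.
have pe : perm_eq (A ++ x :: W ++ mate x :: B) [:: x, mate x & A ++ W ++ B] by perm_count.
by rewrite (well_formed_perm pe) well_formed_pair => /andP[].
Qed.

(** A loop that meets itself contains a shorter loop of welded passages, to be
    removed first.  Here [x] may be real: only the rest of the loop must be
    welded. *)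
Lemma loop_removal A x W B :
    welded_diagram (A ++ x :: W ++ mate x :: B) -> welded_word W ->
  welded_equivalent (A ++ x :: W ++ mate x :: B) (erase (label x :: map label W) (A ++ B))
  /\ welded_diagram (erase (label x :: map label W) (A ++ B)).
Proof.
have [n] := ubnP (size W); elim: n A x W B => // n IH A x W B /ltnSE sn wD lW.
have [wf _] := (welded_diagramP _).1 wD.
have xn := well_formed_loop wf.
have [uW|nu] := boolP (uniq (map label W)).
  have w1 := welded_diagram_rot wD; have e1 := equiv_rot wD.
  rewrite /= -catA /= in w1 e1.
  have [e2 w2] := simple_loop_removal w1 lW uW.
  rewrite erase_cat in e2 w2.
  have -> : erase (label x :: map label W) (A ++ B) = erase (map label W) A ++ erase (map label W) B.
    rewrite -erase_cat; apply: eq_in_filter => v vAB; rewrite inE.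
    suff -> : (label v == label x) = false by [].
    apply: contraNF xn => /eqP<-; apply: map_f.
    by move: vAB; rewrite !mem_cat => /orP[]->; rewrite ?orbT.
  split; last exact: welded_diagram_rot w2.
  exact: welded_trans e1 (welded_trans e2 (equiv_rot w2)).
have [W1 [v [W2 [v' [W3 [WE vv']]]]]] := not_uniq_split nu.
have v'E : v' = mate v.
  have vD : v \in A ++ x :: W ++ mate x :: B by rewrite WE !(mem_cat, inE) eqxx !orbT.
  have vD' : v' \in A ++ x :: W ++ mate x :: B by rewrite WE !(mem_cat, inE) eqxx !orbT.
  have [E|//] := well_formed_eq wf vD' vD vv'.
  have := well_formed_uniq wf; rewrite WE E.
  have pe : perm_eq (A ++ x :: (W1 ++ v :: W2 ++ v :: W3) ++ mate x :: B)
    [:: v, v & A ++ x :: (W1 ++ W2 ++ W3) ++ mate x :: B] by perm_count.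
  by rewrite (perm_uniq pe) /= inE eqxx.
subst v'; have sW2 : size W2 < n.
  apply: leq_trans sn; rewrite WE !size_cat /= size_cat /= addnS ltnS.
  by apply: leq_trans (leq_addl _ _); apply: leq_addr.
have lW2 : welded_word W2 by move: lW; rewrite WE !all_cat /= !all_cat => /and4P[_ _ -> _].
have DE : A ++ x :: W ++ mate x :: B = (A ++ x :: W1) ++ v :: W2 ++ mate v :: (W3 ++ mate x :: B).
  by rewrite WE -?catA /= -?catA /= -?catA.
have w1 := wD; rewrite DE in w1.
have [e1 w2] := IH _ _ _ _ sW2 w1 lW2.
set L2 := label v :: map label W2 in e1 w2.
have xL2 : label x \notin L2.
  have LW : {subset L2 <= map label W}.
    by move=> l; rewrite WE !map_cat /= !map_cat inE !mem_cat !inE !mem_cat => /orP[]->;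
    rewrite ?orbT.
  by apply: contra xn => /LW xW; rewrite !map_cat !mem_cat xW orbT.
have E2 : erase L2 ((A ++ x :: W1) ++ (W3 ++ mate x :: B)) =
    erase L2 A ++ x :: erase L2 (W1 ++ W3) ++ mate x :: erase L2 B.
  by rewrite !erase_cat !erase_keep // -!catA.
rewrite E2 in e1 w2.
have lW' : welded_word (erase L2 (W1 ++ W3)).
  apply/allP=> u; rewrite mem_filter => /andP[_]; rewrite mem_cat => u13.
  apply: (allP lW); rewrite WE !mem_cat !inE !mem_cat inE.
  by case/orP: u13 => ->; rewrite ?orbT.
have sW' : size (erase L2 (W1 ++ W3)) < n.
  apply: leq_trans sn; apply: leq_ltn_trans (size_subseq (filter_subseq _ _)) _.
  rewrite WE !size_cat /= size_cat /= !addnS ltnS ltnW // ltnS leq_add2l.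
  exact: leq_addl.
have [e3 w3] := IH _ _ _ _ sW' w2 lW'.
have EE : erase (label x :: [seq label i | i <- erase L2 (W1 ++ W3)]) (erase L2 A ++ erase L2 B) =
    erase (label x :: map label W) (A ++ B).
  rewrite -erase_cat erase_erase; apply: eq_filter => u; congr (~~ _).
  rewrite mem_cat !inE -!orbA; congr (_ || _).
  rewrite WE !map_cat /= map_cat /= !mem_cat !inE mem_cat inE.
  have [uL2|uL2] := boolP (label u \in L2).
    move: (uL2); rewrite /L2 inE => ->; rewrite orbT; apply/esym.
    by move: uL2; rewrite inE => /orP[]->; rewrite ?orbT.
  move: (uL2); rewrite /L2 inE => /negbTE->; rewrite orbF.
  move: uL2; rewrite inE negb_or => /andP[/negbTE u1 /negbTE u2].
  rewrite u1 u2 /=; apply/mapP/orP => [[t]|].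
    by rewrite mem_filter mem_cat => /andP[_ /orP[]tW ->]; [left | right]; apply: map_f.
  by case=> /mapP[t tW ut]; exists t => //; rewrite mem_filter -ut inE u1 u2 mem_cat tW ?orbT.
rewrite EE in e3 w3; split=> //; rewrite DE.
by apply: welded_trans e1 e3.
Qed.

(** * Words of real passages *)

(** The Gauss word of the real crossings, which is all that matters for the
    welded knot. *)
Definition real_word (D : diagram_code) : diagram_code :=
  [seq v <- D | lev v != Weld].

Lemma real_word_cat s t : real_word (s ++ t) = real_word s ++ real_word t.
Proof. exact: filter_cat. Qed.

Lemma real_word_cons v s :
  real_word (v :: s) = if lev v == Weld then real_word s else v :: real_word s.
Proof. by rewrite /real_word /=; case: eqP. Qed.

Lemma filter_eq_cat (T : Type) (p : pred T) s t u : filter p s = t ++ u ->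
  exists s1 s2, [/\ s = s1 ++ s2, filter p s1 = t & filter p s2 = u].
Proof.
elim: s t => [|v s IH] t /=.
  by case: t => // us; exists [::], [::].
case: ifP => pv.
  case: t => [us|w t /= [<- /IH[s1 [s2 [-> <- <-]]]]].
    by exists [::], (v :: s); rewrite /= pv.
  by exists (v :: s1), s2; rewrite /= pv.
by case/IH=> s1 [s2 [-> <- <-]]; exists (v :: s1), s2; rewrite /= pv.
Qed.

Lemma filter_eq_cons (T : Type) (p : pred T) s v u : filter p s = v :: u ->
  exists s1 s2, [/\ s = s1 ++ v :: s2, filter p s1 = [::], p v & filter p s2 = u].
Proof.
elim: s => //= w s IH; case: ifP => pw.
  by case=> <- <-; exists [::], s.
by case/IH=> s1 [s2 [-> s1E pv <-]]; exists (w :: s1), s2; rewrite /= pw.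
Qed.

Lemma real_word_nil s : real_word s = [::] -> welded_word s.
Proof. by elim: s => //= v s IH; case: eqP => //= _ /IH. Qed.

Lemma real_word_welded s : welded_word s -> real_word s = [::].
Proof. by elim: s => //= v s IH /andP[-> /IH]. Qed.

(** Both passages of a crossing have the same kind of level, so no real crossing
    other than [x] is on a loop of welded passages. *)
Lemma real_word_erase A x W B : well_formed (A ++ x :: W ++ mate x :: B) -> welded_word W ->
  forall s, {subset s <= A ++ B} ->
  real_word (erase (label x :: map label W) s) = real_word s.
Proof.
move=> wf lW s sAB; rewrite /real_word /erase -filter_predI.
apply: eq_in_filter => v /sAB vAB /=.
have [//|vr] := boolP (lev v == Weld); rewrite andTb inE negb_or.
have -> /= : label v != label x.
  apply: contraNneq (well_formed_loop wf) => <-; apply: map_f.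
  by move: vAB; rewrite !mem_cat => /orP[]->; rewrite ?orbT.
apply/negP=> /mapP[q qW vq].
have vD : v \in A ++ x :: W ++ mate x :: B.
  by move: vAB; rewrite !mem_cat !inE mem_cat inE => /orP[]->; rewrite ?orbT.
have qD : q \in A ++ x :: W ++ mate x :: B by rewrite !mem_cat !inE mem_cat qW !orbT.
have /eqP lq := allP lW q qW.
by case: (well_formed_eq wf vD qD vq) vr => ->; rewrite /= lq.
Qed.

Lemma real_word_expand p q a b s : real_word (expand (swap_expansion p q a b) s) = real_word s.
Proof.
elim: s => //= v s IH; rewrite expand_cons real_word_cat IH [RHS](real_word_cat [:: v] s);
  congr (_ ++ _).
rewrite /swap_expansion; case: eqP => _; first by case: (side p).
by case: eqP => _ //; case: (side q).
Qed.

Lemma remove_welded_loop P x W E : welded_diagram (P ++ x :: W ++ mate x :: E) ->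
    welded_word W -> exists2 D', welded_equivalent (P ++ x :: W ++ mate x :: E) D'
    & [/\ welded_diagram D', real_word D' = real_word P ++ real_word E &
       size D' < size (P ++ x :: W ++ mate x :: E)].
Proof.
move=> wD lW; have [e w] := loop_removal wD lW; have [wf _] := (welded_diagramP _).1 wD.
exists (erase (label x :: map label W) (P ++ E)); first exact: e.
split=> //; first by rewrite (real_word_erase wf lW) // real_word_cat.
apply: leq_ltn_trans (size_subseq (filter_subseq _ _)) _.
rewrite !size_cat /= size_cat /= !addnS ltnS; apply: leqW.
by rewrite leq_add2l leq_addl.
Qed.

Lemma swap_in_place P p q E : welded_diagram (P ++ [:: p, q & E]) ->
    label p != label q -> swappable (lev p) (lev q) -> exists a b,
  welded_equivalent (P ++ [:: p, q & E])
    (expand (swap_expansion p q a b) P ++ [:: q, p & expand (swap_expansion p q a b) E]) /\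
  welded_diagram (expand (swap_expansion p q a b) P ++ [:: q, p & expand (swap_expansion p q a b) E]).
Proof.
move=> wD pq ok; pose a := fresh (P ++ [:: p, q & E]); exists a, a.+1.
have w1 := welded_diagram_rot wD; have e1 := equiv_rot wD.
have fr n : a <= n -> n \notin map label ([:: p, q & E] ++ P).
  move/freshP; apply: contra; rewrite !map_cat !mem_cat; by rewrite orbC.
have aa : a != a.+1 by rewrite neq_ltn ltnSn.
have [e2 w2] := equiv_swap w1 pq aa (fr _ (leqnn _)) (fr _ (leqnSn _)) ok.
rewrite expand_cat in e2 w2.
have w3 : welded_diagram ([:: q, p & expand (swap_expansion p q a a.+1) E] ++ expand (swap_expansion p q a a.+1) P) := w2.
split; last exact: welded_diagram_rot w3.
exact: welded_trans e1 (welded_trans e2 (equiv_rot w3)).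
Qed.

(** Two consecutive tails of the real word may be exchanged.  In the diagram
    they are separated by welded passages, past which the second one is
    moved. *)
Lemma tail_swap D G1 y z G2 : welded_diagram D -> lev y = Over -> lev z = Over ->
    real_word D = G1 ++ [:: y, z & G2] ->
  exists2 D', welded_equivalent D D' &
    welded_diagram D' /\ real_word D' = G1 ++ [:: z, y & G2].
Proof.
move=> wD ly lz rD.
have [P [E0 [DE <- r0]]] := filter_eq_cat rD.
have [s0 [E1 [E0E s00 _ r1]]] := filter_eq_cons r0.
have [W1 [E [E1E W10 _ <-]]] := filter_eq_cons r1.
have {rD r0 r1} : D = (P ++ s0) ++ y :: W1 ++ z :: E by rewrite DE E0E E1E -!catA.
have -> : [seq x <- P | lev x != Weld] = real_word (P ++ s0).
  by rewrite real_word_cat /real_word s00 cats0.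
rewrite -/(real_word E).
move: (P ++ s0) (real_word_nil W10) => {DE E0E E1E s00 W10 E1 s0} {}P.
have [n] := ubnP (size W1); elim: n P W1 E D wD => // n IH P W1 E D wD /ltnSE sn lW1 DE.
have [wf _] := (welded_diagramP _).1 wD; have uD := well_formed_uniq wf.
have yz : label y != label z.
  have yD : y \in D by rewrite DE mem_cat mem_head orbT.
  have zD : z \in D by rewrite DE !(mem_cat, inE) eqxx !orbT.
  apply/eqP=> yz; case: (well_formed_eq wf yD zD yz) => E'.
    by move: uD; rewrite DE cat_uniq E' /= mem_cat mem_head orbT !andbF.
  by move: ly; rewrite E' /= lz.
case/lastP: W1 => [|W0 p] in sn lW1 DE.
  rewrite /= in DE; subst D.
  have [|a [b [e w]]] := swap_in_place wD yz; first by rewrite ly lz.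
  exists (expand (swap_expansion y z a b) P ++ [:: z, y & expand (swap_expansion y z a b) E]) => //.
  by split=> //; rewrite real_word_cat !real_word_cons !real_word_expand ly lz.
move: lW1; rewrite all_rcons => /andP[/eqP lp lW0].
rewrite size_rcons in sn; rewrite cat_rcons in DE.
(* If [p] closes a welded loop, exchanging it with [z] would lengthen the gap:
   the exchange also surrounds the other passage of [p] by new ones.  The loop
   is removed instead. *)
have [pW|pW] := boolP (mate p \in W0).
  case/splitPr: pW => Wa Wb in lW0 sn DE *.
  have DE' : D = (P ++ y :: Wa) ++ mate p :: Wb ++ mate (mate p) :: (z :: E).
    by rewrite DE mateK -?catA /= -?catA /= -?catA.
  have wD' := wD; rewrite DE' in wD'.
  move: lW0; rewrite all_cat /= => /and3P[lWa _ lWb].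
  have [e w] := loop_removal wD' lWb; have [wf' _] := (welded_diagramP _).1 wD'.
  have kept := real_word_erase wf' lWb.
  set L := label (mate p) :: map label Wb in e w kept.
  set AB := (P ++ y :: Wa) ++ z :: E in e w kept.
  have keep v : lev v = Over -> v \in AB -> label v \notin L.
    move=> lv vAB; have /kept : {subset [:: v] <= AB} by move=> u; rewrite inE => /eqP->.
    by rewrite /real_word /erase /=; case: (label v \in L); rewrite /= lv.
  have yAB : y \in AB by rewrite /AB !(mem_cat, inE) eqxx !orbT.
  have zAB : z \in AB by rewrite /AB !(mem_cat, inE) eqxx !orbT.
  have EAB : erase L AB = erase L P ++ y :: erase L Wa ++ z :: erase L E.
    by rewrite /AB !erase_cat !erase_keep ?keep // -!catA.
  have sAB (s : diagram_code) : {subset s <= P ++ E} -> real_word (erase L s) = real_word s.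
    move=> sPE; apply: kept => u /sPE; rewrite /AB !(mem_cat, inE) => /orP[]->;
    by rewrite ?orbT.
  have lWa' : welded_word (erase L Wa).
    by apply/allP=> u; rewrite mem_filter => /andP[_ /(allP lWa)].
  have sWa : size (erase L Wa) < n.
    apply: leq_trans sn; apply: leq_ltn_trans (size_subseq (filter_subseq _ _)) _.
    by rewrite size_cat /= addnS ltnS leqW // leq_addr.
  have [D' e' [w' r']] := IH (erase L P) (erase L Wa) (erase L E) _ w sWa lWa' EAB.
  exists D'; first by rewrite DE'; apply: welded_trans e e'.
  split=> //; rewrite r' !sAB // => u us; rewrite mem_cat us ?orbT //.
have DE' : D = (P ++ y :: W0) ++ [:: p, z & E] by rewrite DE -catA.
have wD' := wD; rewrite DE' in wD'.
have pz : label p != label z.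
  have pD : p \in D by rewrite DE' !(mem_cat, inE) eqxx !orbT.
  have zD : z \in D by rewrite DE' !(mem_cat, inE) eqxx !orbT.
  by apply/eqP=> pz; case: (well_formed_eq wf pD zD pz) lp => ->; rewrite /= lz.
have [|a [b [e w]]] := swap_in_place wD' pz; first by rewrite /swappable lp.
set f := swap_expansion p z a b in e w.
have fy : f y = [:: y].
  by rewrite /f /swap_expansion; case: eqP ly => [->|_ ly]; rewrite /= ?lp //;
     case: eqP ly => [->|]; rewrite /= ?lz.
have fW0 : expand f W0 = W0.
  apply: expand_id => u uW; rewrite /f /swap_expansion; case: eqP => [up|_].
    by rewrite -up uW in pW.
  case: eqP => // uz; have /eqP := allP lW0 u uW; by rewrite uz /= lz.
have EE : expand f (P ++ y :: W0) ++ [:: z, p & expand f E] = expand f P ++ y :: W0 ++ z :: (p :: expand f E).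
  by rewrite expand_cat expand_cons fy fW0 -!catA.
have [D' e' [w' r']] := IH _ _ _ _ w sn lW0 EE.
exists D'; first by rewrite DE'; apply: welded_trans e e'.
by split=> //; rewrite r' real_word_cons lp !real_word_expand.
Qed.

Lemma chord_removal D G1 y G2 : welded_diagram D -> real_word D = G1 ++ [:: y, mate y & G2] ->
  exists2 D', welded_equivalent D D' & welded_diagram D' /\ real_word D' = G1 ++ G2.
Proof.
move=> wD rD.
have [P [E0 [DE <- r0]]] := filter_eq_cat rD.
have [s0 [E1 [E0E s00 _ r1]]] := filter_eq_cons r0.
have [W1 [E [E1E W10 _ <-]]] := filter_eq_cons r1.
have DE' : D = (P ++ s0) ++ y :: W1 ++ mate y :: E by rewrite DE E0E E1E -!catA.
rewrite DE' in wD *; have [D' e [w r _]] := remove_welded_loop wD (real_word_nil W10).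
by exists D' => //; split=> //; rewrite r real_word_cat /real_word s00 cats0.
Qed.

Lemma welded_word_trivial D : welded_diagram D -> real_word D = [::] -> welded_trivial D.
Proof.
have [n] := ubnP (size D); elim: n D => // n IH [|v E].
  by move=> _ _ _; apply: rst_refl.
move=> /ltnSE sE wD rD; have [wf _] := (welded_diagramP _).1 wD.
have [A [B [EE _ _]]] := well_formed_split wf; rewrite EE in wD rD sE *.
have lD := real_word_nil rD; move: lD; rewrite /= all_cat /= => /and4P[_ lA _ lB].
have [D' e [w r sD']] := @remove_welded_loop [::] v A B wD lA.
apply: welded_trans e _; apply: IH w _; last by rewrite r !real_word_welded.
exact: leq_trans sD' sE.
Qed.

(** * Descending words *)

Lemma mate_eq u w : (mate u == w) = (u == mate w).
Proof. by rewrite -{1}[w]mateK (inj_eq (inv_inj mateK)). Qed.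

Definition descending (G : diagram_code) : Prop :=
  forall A v B, G = A ++ v :: B -> lev v = Under -> mate v \in A.

(** The first under passage is preceded by over passages only, among them its
    own mate, which is moved next to it; then the crossing disappears.  Stated
    for an arbitrary [Q] so that it also serves for reversed words. *)
Lemma descending_ind (Q : diagram_code -> Prop) :
    Q [::] ->
    (forall G1 y z G2, lev y = Over -> lev z = Over ->
       Q (G1 ++ [:: z, y & G2]) -> Q (G1 ++ [:: y, z & G2])) ->
    (forall G1 y G2, Q (G1 ++ G2) -> Q (G1 ++ [:: y, mate y & G2])) ->
  forall G, uniq G -> {in G, forall v, mate v \in G} -> {in G, forall v, lev v != Weld} ->
    descending G -> Q G.
Proof.
move=> Q0 Qswap Qchord G; have [n] := ubnP (size G); elim: n G => // n IH G /ltnSE sG.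
move=> uG mG rG dG; case FG : [seq v <- G | lev v == Under] => [|h F].
  have overG v : v \in G -> lev v = Over.
    move=> vG; have := rG v vG; case lv: (lev v) => //.
    by have : v \in [seq v <- G | lev v == Under]; [rewrite mem_filter lv vG | rewrite FG].
  case: G => [//|v G] in sG uG mG rG dG overG FG *.
  by have := overG _ (mG _ (mem_head _ _)); rewrite /= overG ?mem_head.
have [T [G2 [GE T0 /eqP lh _]]] := filter_eq_cons FG.
have overT v : v \in T -> lev v = Over.
  move=> vT; have := rG v; rewrite GE mem_cat vT => /(_ isT); case lv: (lev v) => //.
  by have : v \in [seq v <- T | lev v == Under]; [rewrite mem_filter lv vT | rewrite T0].
have hT := dG _ _ _ GE lh; set y := mate h in hT; have hy : h = mate y by rewrite mateK.
have {hT}[T1 [T2 TE]] : exists T1 T2, T = T1 ++ y :: T2.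
  by case/splitPr: hT => T1 T2; exists T1, T2.
have ly : lev y = Over by apply: overT; rewrite TE mem_cat mem_head orbT.
rewrite TE hy -catA /= in GE.
have pe : perm_eq G [:: y, mate y & T1 ++ T2 ++ G2] by rewrite GE; perm_count.
have := uG; rewrite (perm_uniq pe) => /= /and3P[]; rewrite inE negb_or => /andP[_ yn] hn _.
have G'E : [seq u <- G | u \notin [:: y; mate y]] = T1 ++ T2 ++ G2.
  rewrite GE filter_cat /= !inE eqxx /= filter_cat /= !inE eqxx orbT /=.
  rewrite -!filter_cat; apply/all_filterP/allP=> u us; rewrite !inE negb_or.
  by apply/andP; split; [apply: contraNneq yn | apply: contraNneq hn] => <-.
suff QG' : Q (T1 ++ T2 ++ G2).
  have {QG'} : Q (T1 ++ T2 ++ [:: y, mate y & G2]).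
    by rewrite catA; apply: Qchord; rewrite -catA.
  have lT2 z : z \in T2 -> lev z = Over.
    by move=> zT; apply: overT; rewrite TE mem_cat inE zT !orbT.
  rewrite GE; elim: (T2) (T1) lT2 => // z S IHT T' lT QT.
  apply: (Qswap _ _ _ _ ly (lT _ (mem_head _ _))).
  rewrite -cat_rcons; apply: IHT => [t tS|]; last by rewrite cat_rcons.
  by apply: lT; rewrite inE tS orbT.
rewrite -G'E; apply: IH.
- rewrite G'E; apply: leq_trans sG; rewrite (perm_size pe).
  exact: leqnSn.
- exact: filter_uniq.
- move=> v; rewrite !mem_filter => /andP[vn vG]; rewrite mG // andbT.
  by move: vn; rewrite !inE !mate_eq mateK orbC.
- by move=> v; rewrite mem_filter => /andP[_ /rG].
move=> A v B GA lv; have [A' [B0 [GE' A'A r0]]] := filter_eq_cat GA.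
have [s0 [B' [B0E s00 vn _]]] := filter_eq_cons r0.
have := dG (A' ++ s0) v B' _ lv; rewrite GE' B0E -catA => /(_ erefl) mv.
have vmn : mate v \notin [:: y; mate y].
  by move: vn; rewrite !inE !mate_eq mateK orbC.
move: mv; rewrite mem_cat -A'A mem_filter vmn /= => /orP[//|ms].
by have : mate v \in [seq u <- s0 | u \notin [:: y; mate y]];
  [rewrite mem_filter vmn | rewrite s00].
Qed.

Definition unknotting (G : diagram_code) : Prop :=
  forall D, welded_diagram D -> real_word D = G -> welded_trivial D.

Lemma unknotting_nil : unknotting [::].
Proof. exact: welded_word_trivial. Qed.

Lemma unknotting_swap G1 y z G2 : lev y = Over -> lev z = Over ->
  unknotting (G1 ++ [:: z, y & G2]) -> unknotting (G1 ++ [:: y, z & G2]).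
Proof.
move=> ly lz u D wD rD; have [D' e [w' r']] := tail_swap wD ly lz rD.
exact: welded_trans e (u _ w' r').
Qed.

Lemma unknotting_chord G1 y G2 : unknotting (G1 ++ G2) -> unknotting (G1 ++ [:: y, mate y & G2]).
Proof.
move=> u D wD rD; have [D' e [w' r']] := chord_removal wD rD.
exact: welded_trans e (u _ w' r').
Qed.

Section Word.
Variable G : diagram_code.
Hypotheses (uG : uniq G) (mG : {in G, forall v, mate v \in G}) (rG : {in G, forall v, lev v != Weld}).

Lemma descending_unknotting : descending G -> unknotting G.
Proof.
apply: descending_ind => //; [exact: unknotting_nil | exact: unknotting_swap |].
exact: unknotting_chord.
Qed.

(** Both operations on words are invariant under reversal. *)
Lemma ascending_unknotting : descending (rev G) -> unknotting G.
Proof.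
rewrite -{2}[G]revK.
apply: (descending_ind (Q := fun G => unknotting (rev G))); rewrite ?rev_uniq //.
- exact: unknotting_nil.
- move=> G1 y z G2 ly lz; rewrite !rev_cat !rev_cons !cat_rcons.
  exact: unknotting_swap.
- move=> G1 y G2; rewrite !rev_cat !rev_cons !cat_rcons.
  by have := @unknotting_chord (rev G2) (mate y) (rev G1); rewrite mateK.
- by move=> v; rewrite !mem_rev; apply: mG.
- by move=> v; rewrite !mem_rev; apply: rG.
Qed.
End Word.

(** * The unknotting number of a knot diagram *)

Lemma least_exists (A : nat -> Prop) n : A n -> exists2 m, least A m & m <= n.
Proof.
elim/ltn_ind: n => n IH An.
have [[m [Am mn]]|no] := classic (exists m, A m /\ m < n).
  by have [l lA lm] := IH m mn Am; exists l => //; apply: leq_trans lm (ltnW mn).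
exists n => //; split=> // m Am; rewrite leqNgt; apply/negP=> mn.
by apply: no; exists m.
Qed.

Section KnotDiagram.
Variable D : diagram_code.
Hypothesis kD : knot_diagram D.

Let wD : welded_diagram D. Proof. by case/andP: kD. Qed.
Let rD : all (fun v => lev v != Weld) D. Proof. by case/andP: kD. Qed.
Let wf : well_formed D. Proof. by case/welded_diagramP: wD. Qed.
Let uD : uniq D. Proof. exact: well_formed_uniq. Qed.

Definition first_passage (v : visit) : bool := index v D < index (mate v) D.

Lemma first_passage_mate v : v \in D -> first_passage (mate v) = ~~ first_passage v.
Proof.
move=> vD; rewrite /first_passage mateK -leqNgt ltn_neqAle.
suff -> : index (mate v) D != index v D by [].
have mD := well_formed_mate wf vD; apply/eqP=> /(congr1 (nth v D)).
by rewrite !nth_index //; apply/eqP/mate_neq.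
Qed.

Definition first_labels (l : level) : seq nat :=
  [seq label v | v <- D & first_passage v && (lev v == l)].

Let first_eq u v : u \in D -> v \in D -> first_passage u -> first_passage v ->
  label u = label v -> u = v.
Proof.
move=> uD' vD fu fv uv; case: (well_formed_eq wf uD' vD uv) => // E.
by move: fu; rewrite E first_passage_mate // fv.
Qed.

Lemma first_labels_uniq l : uniq (first_labels l).
Proof.
rewrite map_inj_in_uniq ?filter_uniq // => u v.
rewrite !mem_filter => /andP[/andP[fu _] uD'] /andP[/andP[fv _] vD].
exact: first_eq.
Qed.

Lemma first_labels_size :
  size (first_labels Over) + size (first_labels Under) = crossing_number (shadow D).
Proof.
pose F := [seq v <- D | first_passage v].
have -> : crossing_number (shadow D) = size F.
  rewrite /crossing_number /crossings map_fst_shadow -(size_map label F); apply: perm_size.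
  rewrite perm_sym; apply: uniq_perm; rewrite ?undup_uniq //.
    rewrite map_inj_in_uniq ?filter_uniq // => u v.
    by rewrite !mem_filter => /andP[fu uD'] /andP[fv vD]; apply: first_eq.
  move=> x; rewrite mem_undup; apply/mapP/mapP => [[v]|[v vD ->]].
    by rewrite mem_filter => /andP[_ vD] ->; exists v.
  have [fv|fv] := boolP (first_passage v); first by exists v; rewrite // mem_filter fv.
  by exists (mate v); rewrite // mem_filter first_passage_mate // fv well_formed_mate.
rewrite !size_map -(count_predC (fun v => lev v == Over) F) !size_filter !count_filter.
congr (_ + _); first by apply: eq_count => v /=; rewrite andbC.
apply: eq_in_count => v vD /=; rewrite andbC; congr andb.
by have := allP rD v vD; case: (lev v).
Qed.

Lemma well_formed_weld S : well_formed (weld S D).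
Proof.
pose g v := if label v \in S then Visit (label v) Weld (side v) else v.
have lg v : label (g v) = label v by rewrite /g; case: ifP.
have gm v : mate (g v) = g (mate v) by rewrite /g /=; case: ifP.
have ml : map label (weld S D) = map label D.
  by rewrite /weld -map_comp; apply: eq_map => v; exact: lg.
rewrite /well_formed ml all_map; apply/allP=> v vD /=; rewrite -/(g v) lg gm.
have /andP[mv ->] := allP wf v vD; rewrite andbT.
by apply: map_f.
Qed.

Lemma welded_diagram_weld S : welded_diagram (weld S D).
Proof.
rewrite /welded_diagram well_formed_weld.
suff -> : shadow (weld S D) = shadow D by case/andP: wD.
by rewrite /shadow /weld -map_comp; apply: eq_map => v /=; case: ifP.
Qed.

Lemma real_word_weld S : real_word (weld S D) = [seq v <- D | label v \notin S].
Proof.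
rewrite /real_word /weld; elim: D rD => //= v s IH /andP[lv rs].
by have [vS|vS] := boolP (label v \in S); rewrite /= ?lv IH.
Qed.

Let remaining l := [seq v <- D | label v \notin first_labels l].

Let remaining_second l v : v \in D -> lev v = l -> label v \notin first_labels l ->
  first_passage (mate v).
Proof.
move=> vD lv; rewrite first_passage_mate //; apply: contra => fv.
by apply/mapP; exists v; rewrite // mem_filter fv lv eqxx.
Qed.

Let remaining_word l : [/\ uniq (remaining l), {in remaining l, forall v, mate v \in remaining l}
  & {in remaining l, forall v, lev v != Weld}].
Proof.
split; first exact: filter_uniq.
- by move=> v; rewrite !mem_filter => /andP[-> /(well_formed_mate wf)->].
- by move=> v; rewrite mem_filter => /andP[_ /(allP rD)].
Qed.

Lemma weld_under_first_trivial : welded_trivial (weld (first_labels Under) D).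
Proof.
have [u m r] := remaining_word Under.
apply: (descending_unknotting u m r) (welded_diagram_weld _) (real_word_weld _).
move=> A v B /filter_eq_cat[A' [B0 [DE A'A r0]]] lv.
have [s0 [B' [B0E s00 vn _]]] := filter_eq_cons r0.
have DE' : D = (A' ++ s0) ++ v :: B' by rewrite DE B0E catA.
have vD : v \in D by rewrite DE' mem_cat mem_head orbT.
have := remaining_second vD lv vn; rewrite /first_passage mateK => im.
have : mate v \in (A' ++ s0).
  move: im uD; rewrite DE' !(index_cat _ (A' ++ s0)); case: ifP => // _.
  case: ifP => [vA _|_]; last by rewrite /= eqxx addn0 ltnNge leq_addr.
  by rewrite cat_uniq => /and3P[_ /hasPn/(_ v)]; rewrite mem_head vA => /(_ isT).
rewrite -A'A mem_cat mem_filter /= vn => /orP[->//|ms].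
by have : mate v \in [seq v <- s0 | label v \notin first_labels Under];
  [rewrite mem_filter /= vn | rewrite s00].
Qed.

Lemma weld_over_first_trivial : welded_trivial (weld (first_labels Over) D).
Proof.
have [u m r] := remaining_word Over.
apply: (ascending_unknotting u m r) (welded_diagram_weld _) (real_word_weld _).
move=> A v B GE lv.
have {}GE : remaining Over = (rev B ++ [:: v]) ++ rev A.
  by rewrite -[remaining _]revK GE rev_cat rev_cons -cats1.
have [B1 [A' [DE r1 A'A]]] := filter_eq_cat GE.
have [B' [v1 [B1E _ r2]]] := filter_eq_cat r1.
have [s0 [s1 [v1E s00 vn s10]]] := filter_eq_cons r2.
have DE' : D = (B' ++ s0) ++ v :: (s1 ++ A') by rewrite DE B1E v1E -!catA.
have vD : v \in D by rewrite DE' mem_cat mem_head orbT.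
have mD := well_formed_mate wf vD.
have lm : lev (mate v) = Over by rewrite /= lv.
have := remaining_second mD lm vn; rewrite mateK /first_passage => im.
have : mate v \in s1 ++ A'.
  move: mD; rewrite DE' mem_cat inE (negbTE (mate_neq v)) /= => /orP[mB|//].
  move: im uD; rewrite DE' !(index_cat _ (B' ++ s0)) mB; case: ifP => [vB _|_].
    by rewrite cat_uniq => /and3P[_ /hasPn/(_ v)]; rewrite mem_head vB => /(_ isT).
  by rewrite /= eqxx addn0 ltnNge index_size.
rewrite -[mate v \in A]mem_rev -A'A mem_cat mem_filter /= vn => /orP[ms|->//].
by have : mate v \in [seq v <- s1 | label v \notin first_labels Over];
  [rewrite mem_filter /= vn | rewrite s10].
Qed.

(** The crossings first met from above and those first met from below partition
    the set of crossings, and welding either part unknots the diagram. *)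
Lemma welded_unknotting_number_half :
  exists2 u, welded_unknotting_number D u & u.*2 <= crossing_number (shadow D).
Proof.
have labels l : {subset first_labels l <= classical_crossings D}.
  move=> x /mapP[v]; rewrite mem_filter => /andP[_ vD] ->.
  rewrite mem_undup; apply: map_f; rewrite mem_filter vD andbT.
  exact: (allP rD).
have [ou|uo] := leqP (size (first_labels Over)) (size (first_labels Under)).
  have [|u lu us] := @least_exists (fun m => exists S : seq nat,
    [/\ uniq S, {subset S <= classical_crossings D}, size S = m
      & welded_trivial (weld S D)]) (size (first_labels Over)).
    exists (first_labels Over); split=> //;
    [exact: first_labels_uniq | exact: weld_over_first_trivial].
  exists u => //; rewrite -first_labels_size -addnn leq_add //.
  exact: leq_trans us ou.
have [|u lu us] := @least_exists (fun m => exists S : seq nat,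
    [/\ uniq S, {subset S <= classical_crossings D}, size S = m
      & welded_trivial (weld S D)]) (size (first_labels Under)).
  exists (first_labels Under); split=> //;
  [exact: first_labels_uniq | exact: weld_under_first_trivial].
exists u => //; rewrite -first_labels_size -addnn leq_add //.
exact: leq_trans us (ltnW uo).
Qed.
End KnotDiagram.

(** * Isolated regions *)

Section Isolation.
Variable P : projection_code.
Hypothesis wP : well_paired P.
Hypothesis P0 : P != [::].
Hypothesis sP : spherical P.

(** The constant flow is the boundary of one colour class of the checkerboard
    colouring. *)
Lemma checkerboard : exists2 f, f \in face_functions P & forall j : edge P, f (j, true) != f (j, false).
Proof.
have [k [i [kj /(coherentP P0) [iE co] fl]]] := (sphericalP wP P0).1 sP (fun _ => false) true.
exists (dart_values P k); first exact: dart_valuesP.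
suff fA (j : edge P) : flow (after k (passage j)).
  by move=> j; have := fA j; rewrite /flow !ffunE /=; case: (after _ _) => [[] []].
apply: (edge_ind (Q := fun j => flow (after k (passage j)))) => [|{}j jE].
  by rewrite -co ord_predK -iE.
by rewrite flow_after co kj ?map_f ?passage_mem // addbF.
Qed.

(** A flow that jumps at a single crossing distinguishes the two opposite regions
    there when the other two corners belong to the same region. *)
Lemma crossing_separator x : exists2 f, f \in face_functions P &
  forall j : edge P, (passage j).1 = x ->
    f (ord_pred j, true) (+) f (ord_pred j, false) (+) (f (j, true) (+) f (j, false)).
Proof.
have [k [i [kj /(coherentP P0) [iE co] fl]]] := (sphericalP wP P0).1 sP (pred1 x) false.
exists (dart_values P k); first exact: dart_valuesP.
move=> j jx; rewrite !ffunE /= -!/(flow _) -(co (ord_pred j)) ord_predK flow_after.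
by rewrite addKb kj ?map_f ?passage_mem //= jx eqxx.
Qed.

Lemma region_neq f e e' : f \in face_functions P -> f e != f e' -> region e != region e'.
Proof.
move=> fI; apply: contra; rewrite eq_region // => h.
by rewrite (face_function_connect fI h).
Qed.

Lemma region_step (e : dart P) : region (face_step e) = region e.
Proof. by apply/eqP; rewrite eq_sym eq_region // fconnect1. Qed.

(** At the crossing of a kink two opposite corners belong to the same region, and
    the two other ones to distinct regions: the monogon and the region opposite
    to it. *)
Lemma kink_reducible (j : edge P) : other j = ordS j -> reducible_crossing P (passage j).1.
Proof.
move=> oj; have [ch chI chE] := checkerboard.
have [se seI seE] := crossing_separator (passage j).1.
have oSj : other (ordS j) = j by rewrite -oj otherK.
have pSj : passage (ordS j) = pmate (passage j) by rewrite -oj other_passage.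
pose d1 : dart P := (ord_pred j, true); pose d2 : dart P := (j, false).
pose d3 : dart P := (j, true); pose d4 : dart P := (ordS j, false).
have hd1 : dart_head d1 = j by rewrite /dart_head /= ord_predK.
have hd3 : dart_head d3 = ordS j by [].
have atx (e : dart P) : (passage (dart_head e)).1 = (passage j).1 -> e \in [:: d1; d2; d3; d4].
  move=> ex; have : dart_head e = j \/ dart_head e = ordS j.
    have [E|E] := eqVneq (passage (dart_head e)).2 (passage j).2; [left|right].
      by apply: (can_inj (passageK wP P0)); move: ex E;
      case: (passage _) (passage j) => [? ?] [? ?] /= -> ->.
    apply: (can_inj (passageK wP P0)); rewrite pSj /pmate -ex.
    by move: E; case: (passage (dart_head e)) => [y []]; case: (passage j).2.
  case: e {ex} => i [] /=; rewrite /dart_head /= !inE /d1 /d2 /d3 /d4 => -[] E.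
  - by rewrite -E ordSK eqxx.
  - by rewrite (ordS_inj E) eqxx !orbT.
  - by rewrite E eqxx !orbT.
  - by rewrite E eqxx !orbT.
have on_x R : R \in regions P -> on_boundary (passage j).1 R =
    [|| R == region d1, R == region d2, R == region d3 | R == region d4].
  case/imsetP=> e0 _ ->; rewrite -/(region e0).
  apply/existsP/idP => [[e /andP[eR]]|].
    rewrite onth_passage //= => /eqP[/atx ed].
    have -> : region e0 = region e by apply/eqP; rewrite eq_region //; move: eR; rewrite inE.
    by move: ed; rewrite !inE => /or4P[]/eqP->; rewrite eqxx ?orbT.
  have at_d d : dart_head d = j \/ dart_head d = ordS j -> region e0 = region d ->
      exists e, (e \in region e0) && (omap fst (onth P (dart_head e)) == Some (passage j).1).
    move=> hd E; exists d; rewrite E inE connect0 onth_passage //=.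
    by case: hd => ->; rewrite ?pSj.
  by case/or4P=> /eqP; apply: at_d; rewrite ?hd1; [left | left | right | right].
have fsE := face_stepE P0.
have ne12 : region (ord_pred j, true) != region (ord_pred j, false) by apply: region_neq chI (chE _).
have ne23 : region d3 != region d2 by apply: region_neq chI (chE _).
have sum := seE j erefl.
have reg_set (A B C : {set dart P}) : A \in regions P -> B \in regions P -> C \in regions P ->
   (forall R, R \in regions P -> on_boundary (passage j).1 R = [|| R == A, R == B | R == C]) ->
   A != B -> A != C -> B != C -> reducible_crossing P (passage j).1.
  move=> rA rB rC onE AB AC BC; rewrite /reducible_crossing.
  rewrite (_ : [set R in _ | _] = [set A; B; C]); last first.
    apply/setP=> R; rewrite !inE -orbA; apply/andP/idP => [[rR]|h]; first by rewrite onE.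
    have rR : R \in regions P by case/or3P: h => /eqP->.
    by rewrite onE.
  by rewrite -setUA cardsU1 cards2 !inE negb_or AB AC BC.
have rr d : region d \in regions P by apply/imsetP; exists d.
have eqr d d' : face_step d = d' -> region d = region d' /\ se d = se d'.
  move=> <-; rewrite region_step; split=> //.
  by move: seI; rewrite inE => /forallP/(_ d)/eqP.
have [s|s] := boolP (passage j).2.
  have /eqr[r34 v34] : face_step d3 = (ord_pred j, false).
    by rewrite fsE hd3 pSj /= s /= oSj.
  have /eqr[r43 _] : face_step d4 = d3.
    by rewrite fsE /dart_head /= pSj /= s /= oSj.
  apply: (reg_set (region d1) (region d2) (region d3)) => //.
  - by move=> R rR; rewrite on_x // r43 orbb.
  - apply: (region_neq seI); apply/eqP=> d12; move: sum; rewrite -v34 -/d1 -/d2 -/d3 d12.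
    by case: (se d2); case: (se d3).
  - by rewrite r34.
  - by rewrite eq_sym.
have /eqr[r12 v12] : face_step d1 = d2.
  by rewrite fsE hd1 (negbTE s) /= oj ordSK.
have /eqr[r4 v4] : face_step d4 = (ord_pred j, false).
  by rewrite fsE /dart_head /= pSj /= (negbTE s) /= oSj.
apply: (reg_set (region d2) (region d3) (region d4)) => //.
- by move=> R rR; rewrite on_x // r12 orbA orbb.
- by rewrite eq_sym.
- by rewrite r4 -r12.
apply: (region_neq seI); rewrite v4; apply/eqP=> d34; move: sum; rewrite -/d1 -/d2 -/d3 v12 d34.
by case: (se d2); case: (se _).
Qed.

(** Two consecutive darts around the region head to distinct crossings, unless
    the second one is a kink. *)
Lemma region_two_crossings R : irreducible P -> R \in regions P ->
  1 < count (fun x => on_boundary x R) (crossings P).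
Proof.
move=> irr /imsetP[e _ RE]; rewrite -/(region e) in RE.
have on_e e' : region e' = R -> on_boundary (passage (dart_head e')).1 R.
  by move=> <-; apply/existsP; exists e'; rewrite inE connect0 onth_passage //= eqxx.
set x := (passage (dart_head e)).1; set y := (passage (dart_head (face_step e))).1.
have xP : x \in crossings P by rewrite mem_undup map_f // passage_mem.
have yP : y \in crossings P by rewrite mem_undup map_f // passage_mem.
have onx : on_boundary x R by apply: on_e.
have ony : on_boundary y R by apply: on_e; rewrite region_step.
have [xy|xy] := eqVneq x y; last first.
  rewrite -size_filter; apply: (@uniq_leq_size _ [:: x; y]); first by rewrite /= inE xy.
  by move=> z; rewrite !inE mem_filter => /orP[]/eqP->; rewrite ?onx ?ony.
have [j jx Sjx] : exists2 j : edge P, (passage j).1 = x & (passage (ordS j)).1 = x.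
  have : (passage (dart_head (face_step e))).1 = x by rewrite -/y -xy.
  rewrite face_stepE //; case: ifP => _; rewrite /dart_head /= => h.
    by exists (other (dart_head e)) => //; rewrite other_passage.
  by exists (ord_pred (other (dart_head e))); rewrite ?ord_predK ?other_passage.
suff oj : other j = ordS j.
  by have := allP irr x xP; rewrite -jx kink_reducible.
have Sj : ordS j != j.
  apply/eqP=> Sj; have same (i : edge P) : (i == j) = (ord_pred ord0 == j).
    apply: (edge_ind (Q := fun i => (i == j) = (ord_pred ord0 == j))) => // {}i <-.
    by rewrite -{1}Sj (inj_eq (@ordS_inj _)).
  have constP (i : edge P) : i = j by apply/eqP; rewrite same -(same j).
  have := other_passage wP P0 j; rewrite [other j]constP => /(congr1 snd) /=.
  by case: (passage j).2.
apply: (can_inj (passageK wP P0)); rewrite other_passage //.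
have [E|E] := eqVneq (passage (ordS j)).2 (passage j).2.
  case/eqP: Sj; apply: (can_inj (passageK wP P0)).
  by rewrite [LHS]surjective_pairing [RHS]surjective_pairing E Sjx jx.
rewrite [RHS]surjective_pairing Sjx -jx /pmate; congr pair.
by case: (passage j).2 E; case: (passage (ordS j)).2.
Qed.

(** A crossing lies on the boundary of at most one region of an isolated set,
    and each of these regions has two crossings. *)
Lemma isolation_number_half : irreducible P -> (isolation_number P).*2 <= crossing_number P.
Proof.
move=> irr; rewrite -geq_half_double; apply/bigmax_leqP=> S /andP[/subsetP SR iso].
rewrite geq_half_double -muln2 -sum_nat_const.
apply: (@leq_trans (\sum_(R in S) \sum_(x <- crossings P) on_boundary x R)).
  apply: leq_sum => R RS; rewrite (leq_trans (region_two_crossings irr (SR R RS))) //.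
  by rewrite -sum1_count big_mkcond; apply: leq_sum => x _; case: (on_boundary x R).
rewrite exchange_big /=; apply: (@leq_trans (\sum_(x <- crossings P) 1)); last first.
  by rewrite sum1_size.
rewrite [X in X <= _]big_seq [X in _ <= X]big_seq; apply: leq_sum => x xP.
apply: (@leq_trans #|[set R in S | on_boundary x R]|).
  rewrite -sum1dep_card big_mkcondr /=; apply: leq_sum => R _.
  by case: (on_boundary x R).
apply/card_le1_eqP => R R'; rewrite !inE => /andP[RS xR] /andP[RS' xR'].
apply/eqP/negPn/negP=> RR'; have := forallP iso R; rewrite RS => /forallP/(_ R').
by rewrite RS' eq_sym RR' /= => /allP/(_ x xP); rewrite xR xR'.
Qed.

End Isolation.

(** * The inequality *)

Theorem corollary5 (D : diagram_code)
    (D_knot : knot_diagram D)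
    (D_irr : irreducible (shadow D))
    (c_bounds : 1 <= crossing_number (shadow D) <= 9)
    (D_not_exceptional :
       ~ [/\ irreducible (shadow D), crossing_number (shadow D) = 8
           & projection_warping_degree (shadow D) 2]) :
  exists u : nat, welded_unknotting_number D u /\
    (u%:Z <= (crossing_number (shadow D))%:Z
             - (isolation_number (shadow D))%:Z :> int)%R.
Proof.
have [u uD u2] := welded_unknotting_number_half D_knot.
have /andP[/andP[wf sP] _] := D_knot.
have P0 : shadow D != [::] by case/andP: c_bounds => + _; case: (shadow D).
have I2 := isolation_number_half (well_formed_paired wf) P0 sP D_irr.
exists u; split=> //; move: u2 I2; clear.
move: (crossing_number _) (isolation_number _) => c i; lia.
Qed.
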